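(* Let $1\le k\le n-1$, and let $\mathbb{F}_q$ be a finite field with $q$ elements, $q$ a power of a prime. Assume $\sqrt{-1}\in\mathbb{F}_q$. Let $p(x)=(-1)^{k(n-k)}\sum_{w\in S_n^{(k)}}(-1)^{\ell(w)}x^{\eta(w)}\in\mathbb{Z}[x]$. Then $$|\mathrm{Gr}(k,n)_{\mathbb{F}_q}|=q^{r}\,p(q)\qquad\text{with}\qquad r=k(n-k)-\deg p .$$
   Context: $\mathrm{Gr}(k,n)_{\mathbb{F}_q}$: the real Grassmannian $\mathrm{Gr}(k,n)$ of $k$-dimensional subspaces of $\mathbb{R}^n$ is described as $K/(L\cap K)$, where $K=\mathrm{SO}_n(\mathbb{R})$ and $L$ is the Levi factor (block diagonal matrices with blocks of sizes $k$ and $n-k$) of the maximal parabolic subgroup $P_k$ containing the Borel subgroup of upper triangular matrices in $\mathrm{SL}_n(\mathbb{R})$. One considers $K/(L\cap K)$ over other fields, such as $\mathbb{C}$, $\overline{\mathbb{F}}_q$ or the finite field $\mathbb{F}_q$; this gives $\mathrm{Gr}(k,n)_{\mathbb{F}_q}$, and $|\mathrm{Gr}(k,n)_{\mathbb{F}_q}|$ denotes its number of $\mathbb{F}_q$-points, i.e. the number of points of the variety $K/(L\cap K)$ over $\overline{\mathbb{F}}_q$ fixed by the Frobenius map $x\mapsto x^q$. (This is not the set of all $k$-dimensional subspaces of $\mathbb{F}_q^n$.) $S_n$ is the symmetric group with length function $\ell$; $S_n^{(k)}$ is the set of minimal length coset representatives of $S_n/(S_k\times S_{n-k})$, i.e.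 the $w\in S_n$ with $w(1)<\cdots<w(k)$ and $w(k+1)<\cdots<w(n)$; for these $\ell(w)=\sum_{j=1}^k(w(j)-j)$. $Y_w$ is the Young diagram of left-justified boxes contained in the $k\times(n-k)$ rectangle having $w(j)-j$ boxes in the $j$-th row from the bottom, $j=1,\dots,k$. $\eta(w)$ is the number of boxes of $Y_w$ (in the $a$-th row from the top and $b$-th column) with $a+b$ even; i.e. the number of letters $q$ when the boxes are filled with $q$ and $1$ in a checkerboard pattern with $q$ in the northwest corner.
   Formalization: The formal theorem additionally assumes q odd; in characteristic 2 the stated formula fails (for k=1, n=2 there are q fixed points, while q^r p(q) = q-1). *)

(* Defs.v *)
From mathcomp Require Import all_boot all_order all_algebra all_fingroup all_field.
From mathcomp Require Import boolp classical_sets functions cardinality.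

Set Implicit Arguments.
Unset Strict Implicit.
Unset Printing Implicit Defensive.

Import GRing.Theory.
Local Open Scope ring_scope.

(** 'I_n = {0, ..., n-1} plays the role of {1, ..., n} throughout. *)

(** * The variety K / (L :&: K) and its Frobenius-fixed points *)

Section Grassmannian.
Local Open Scope classical_set_scope.
Variables (R : comNzRingType) (n : nat).

Definition SO : set 'M[R]_n :=
  [set g | g^T *m g = 1%:M /\ \det g = 1].

(** The standard Levi factor of the maximal parabolic P_k of SL_n. *)
Definition Levi (k : nat) : set 'M[R]_n :=
  [set g | \det g = 1 /\
    forall i j : 'I_n, (i < k)%N != (j < k)%N -> g i j = 0].

Definition mxlcoset (g : 'M[R]_n) (H : set 'M[R]_n) : set 'M[R]_n :=
  [set g *m h | h in H].

(** Over an algebraically closed field the points of the quotient variety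
    K / (L :&: K) are the cosets of the group of points of L :&: K in the
    group of points of K; a point is represented by its coset. *)
Definition Gr (k : nat) : set (set 'M[R]_n) :=
  [set mxlcoset g (Levi k `&` SO) | g in SO].

Definition frobenius_mx (q : nat) (g : 'M[R]_n) : 'M[R]_n :=
  map_mx (fun x => x ^+ q) g.

Definition Gr_frobenius_fixed (k q : nat) : set (set 'M[R]_n) :=
  [set C | Gr k C /\ frobenius_mx q @` C = C].

End Grassmannian.

Arguments SO : clear implicits.
Arguments Levi : clear implicits.
Arguments Gr : clear implicits.
Arguments Gr_frobenius_fixed : clear implicits.

(** * The symmetric group *)

Section Symmetric.
Variable n : nat.

Definition simple_transpositions : {set 'S_n} :=
  [set s | [exists i : 'I_n, exists j : 'I_n,
              (j == i.+1 :> nat) && (s == tperm i j)]].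

Definition product_of_simple (w : 'S_n) : pred nat := fun m =>
  [exists c : {ffun 'I_m -> 'S_n},
     [forall i, c i \in simple_transpositions] && (w == (\prod_i c i)%g)].

Lemma tperm_gen_simple (d : nat) (i j : 'I_n) :
  (j = i + d :> nat)%N -> tperm i j \in <<simple_transpositions>>%g.
Proof.
elim: d j => [|d IHd] j Ej.
  have -> : j = i by apply: val_inj; rewrite /= Ej addn0.
  by rewrite tperm1 group1.
have ltm : (i + d < n)%N by apply: leq_ltn_trans (ltn_ord j); rewrite Ej leq_add2l.
pose m := Ordinal ltm.
have Gmj : tperm m j \in <<simple_transpositions>>%g.
  apply: mem_gen; rewrite inE; apply/existsP; exists m; apply/existsP; exists j.
  by rewrite Ej /= addnS !eqxx.
have Gim := IHd m erefl.
case: (posnP d) => [d0 | d_gt0].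
  suff -> : i = m by [].
  by apply: val_inj; rewrite /= d0 addn0.
have -> : tperm i j = (tperm i m ^ tperm m j)%g.
  rewrite tpermJ tpermL tpermD //; apply/eqP => /(congr1 val) /= E.
    by move: d_gt0; rewrite -(ltn_add2l i) addn0 E ltnn.
  by move: (leq_addr d i); rewrite leqNgt -{2}E Ej addnS ltnSn.
by rewrite groupJ.
Qed.

Lemma ex_product_of_simple (w : 'S_n) : exists m, product_of_simple w m.
Proof.
have : w \in <<simple_transpositions>>%g.
  have [ts -> _] := prod_tpermP w.
  apply: group_prod => -[i j] _ /=.
  case: (leqP i j) => [le_ij | /ltnW le_ji].
    by apply: (@tperm_gen_simple (j - i)); rewrite subnKC.
  by rewrite tpermC; apply: (@tperm_gen_simple (i - j)); rewrite subnKC.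
case/gen_prodgP => m [c Sc ->]; exists m; apply/existsP.
exists [ffun i => c i]; apply/andP; split.
  by apply/forallP => i; rewrite ffunE.
by apply/eqP; apply: eq_bigr => i _; rewrite ffunE.
Qed.

Definition perm_length (w : 'S_n) : nat := ex_minn (ex_product_of_simple w).

Definition min_coset_reps (k : nat) : {set 'S_n} :=
  [set w : 'S_n | [forall i : 'I_n, forall j : 'I_n,
     (i < j)%N && ((j < k)%N || (k <= i)%N) ==> (w i < w j)%N]].

(** The box (a, b) lies in row a from the top, i.e. in row j from the bottom
    with a + j = k - 1. On [min_coset_reps k] one has j <= w j for j < k, so
    the subtraction does not truncate. *)
Definition young_diagram (k : nat) (w : 'S_n) : {set 'I_k * 'I_(n - k)} :=
  [set ab : 'I_k * 'I_(n - k) |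
     [exists j : 'I_n, (ab.1 + j == k.-1)%N && (ab.2 < w j - j)%N]].

(** Shifting both coordinates by one does not change the parity of a + b. *)
Definition eta (k : nat) (w : 'S_n) : nat :=
  #|[set ab : 'I_k * 'I_(n - k) in young_diagram k w | ~~ odd (ab.1 + ab.2)]|.

Definition gr_poly (k : nat) : {poly int} :=
  (-1) ^+ (k * (n - k)) *
  \sum_(w in min_coset_reps k) (-1) ^+ perm_length w * 'X^(eta k w).

End Symmetric.

(* Main.v *)
(** A coset [g (L :&: K)] is determined by the orthogonal projection onto the span of the first
    [k] columns of [g], and over an algebraically closed field every symmetric idempotent of
    rank [k] arises in this way; so the Frobenius-fixed cosets are counted by the symmetric
    idempotents of rank [k] over [F_q], i.e. by the nondegenerate [k]-spaces of the form
    [x_1^2 + ... + x_n^2].  These fall into two types according to their discriminant, and a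
    space of type [D] is counted by (frames with Gram matrix [D] in [F_q^n]) divided by (frames
    with Gram matrix [D] in itself).  By Witt's theorem for unit vectors both numbers are products
    of sizes of spheres, which [sqrt (-1)] makes easy to compute since [x^2 + y^2] is hyperbolic.

    On the other side, splitting the coset representatives according to whether [n] is the image
    of [n] or of [k] adds or removes the top row of the Young diagram; together with the
    generating function for the opposite colouring of the checkerboard this is a Pascal-type
    recurrence.  Its solution, a Gaussian binomial in [x^2] up to an elementary factor, matches
    the number of nondegenerate subspaces up to the power of [q] given by its degree. *)

From HB Require Import structures.
Require Import Defs.
From mathcomp Require Import all_boot all_order all_algebra all_fingroup all_field.
From mathcomp Require Import boolp classical_sets functions cardinality.
From mathcomp Require Import zify ring.

Set Implicit Arguments.
Unset Strict Implicit.
Unset Printing Implicit Defensive.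

Import GRing.Theory.
Local Open Scope ring_scope.

(** * The generating polynomial of the coset representatives *)

(** Simple transpositions are odd, so the parity of any word for [w] is its sign. This trades the
    length for a quantity that [lift_perm] transforms in a known way. *)
Lemma odd_perm_length (n : nat) (w : 'S_n) : odd (perm_length w) = odd_perm w.
Proof.
rewrite /perm_length; case: ex_minnP => m /existsP[c /andP[/forallP simple_c /eqP ->]] _.
have odd_c i : odd_perm (c i).
  move: (simple_c i); rewrite inE => /existsP[a /existsP[b /andP[/eqP ba /eqP ->]]].
  by rewrite odd_tperm; apply/eqP => ab; move: ba; rewrite ab => /n_Sn.
rewrite (big_morph _ (@odd_permM _) (odd_perm1 _)).
rewrite (eq_bigr (fun=> true)) => [|i _]; last exact: odd_c.
rewrite big_const card_ord; by elim: m {c simple_c odd_c} => //= m ->.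
Qed.

Lemma min_coset_repsP (n k : nat) (w : 'S_n) :
  reflect (forall i j : 'I_n, (i < j)%N -> (j < k)%N || (k <= i)%N -> (w i < w j)%N)
          (w \in min_coset_reps n k).
Proof.
rewrite inE; apply: (iffP forallP) => [mono_w i j ij kij | mono_w i].
  by move: (mono_w i) => /forallP/(_ j); rewrite ij kij.
by apply/forallP => j; apply/implyP => /andP[ij kij]; apply: mono_w.
Qed.

(** At any other position the next entry lies in the same block and would have to exceed the
    maximum. *)
Lemma min_coset_reps_last (n k : nat) (w : 'S_n.+1) (i : 'I_n.+1) :
  w \in min_coset_reps n.+1 k.+1 -> w i = ord_max -> (i == n :> nat) || (i == k :> nat).
Proof.
move=> /min_coset_repsP mono_w wi; apply/negPn; rewrite negb_or; apply/negP => /andP[i_n i_k].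
have lt_i : (i.+1 < n.+1)%N by have := ltn_ord i; lia.
have /= := mono_w i (Ordinal lt_i) (ltnSn i).
rewrite wi /= => /(_ _); have := ltn_ord (w (Ordinal lt_i)).
by move=> h1 h2; have := h2 ltac:(lia); lia.
Qed.

Lemma min_coset_reps_lift_max (n k : nat) (s : 'S_n) :
  (k <= n)%N ->
  (lift_perm ord_max ord_max s \in min_coset_reps n.+1 k) = (s \in min_coset_reps n k).
Proof.
move=> le_kn; apply/min_coset_repsP/min_coset_repsP => mono_s i j.
  move=> ij kij; have := mono_s (lift ord_max i) (lift ord_max j).
  by rewrite !lift_perm_lift !lift_max; apply.
case: (unliftP ord_max i) => [i' ->|->]; case: (unliftP ord_max j) => [j' ->|->].
- by rewrite !lift_perm_lift !lift_max; apply: mono_s.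
- by move=> _ _; rewrite lift_perm_id lift_perm_lift lift_max /= ltn_ord.
- by rewrite lift_max /= => /ltn_trans /(_ (ltn_ord j')); rewrite ltnn.
- by rewrite ltnn.
Qed.

Lemma min_coset_reps_lift_mid (n k : nat) (s : 'S_n) (k0 : 'I_n.+1) :
  k0 = k :> nat ->
  (lift_perm k0 ord_max s \in min_coset_reps n.+1 k.+1) = (s \in min_coset_reps n k).
Proof.
move=> k0k; apply/min_coset_repsP/min_coset_repsP => mono_s i j.
  move=> ij kij; have := mono_s (lift k0 i) (lift k0 j).
  by rewrite !lift_perm_lift !lift_max /= /bump k0k; apply; lia.
case: (unliftP k0 i) => [i' ->|->]; case: (unliftP k0 j) => [j' ->|->].
- rewrite !lift_perm_lift !lift_max /= /bump k0k => h1 h2.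
  by apply: mono_s; lia.
- by move=> _ _; rewrite lift_perm_id lift_perm_lift lift_max /= ltn_ord.
- by rewrite /= /bump k0k; lia.
- by rewrite ltnn.
Qed.

Lemma sum_lift_perm (R : nmodType) (n : nat) (P : pred 'S_n.+1) (f : 'S_n.+1 -> R)
    (i0 j0 : 'I_n.+1) :
  \sum_(w : 'S_n.+1 | P w && (w i0 == j0)) f w =
  \sum_(s : 'S_n | P (lift_perm i0 j0 s)) f (lift_perm i0 j0 s).
Proof.
rewrite (reindex (lift_perm i0 j0)) /=; last first.
  (* [r i s] is [s] with position [i] and value [s i] deleted; it inverts [lift_perm], and its own
     inverse is the same deletion performed on [s^-1]. *)
  pose r i (s : 'S_n.+1) k := odflt k (unlift (s i) (s (lift i k))).
  have rK i (s : 'S_n.+1) k : lift (s i) (r i s k) = s (lift i k).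
    rewrite /r; have := neq_lift i k.
    by rewrite -(can_eq (permK s)) => /unlift_some[] ? ? ->.
  have inj_r s : injective (r i0 s).
    apply: can_inj (r (s i0) s^-1%g) _ => k.
    by rewrite {1}/r rK !permK liftK.
  exists (fun s => perm (inj_r s)) => [s _ | s].
    by apply/permP => k; rewrite permE /r lift_perm_lift lift_perm_id liftK.
  rewrite inE => /andP[_ /eqP si0]; apply/permP => k.
  case: (unliftP i0 k) => [k' ->|->]; rewrite ?lift_perm_id //.
  by rewrite lift_perm_lift -si0 permE rK.
by apply: eq_bigl => s; rewrite lift_perm_id eqxx andbT.
Qed.

Lemma sum_min_coset_reps (R : nmodType) (n k : nat) (f : 'S_n.+1 -> R) (k0 : 'I_n.+1) :
  k0 = k :> nat -> (k < n)%N ->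
  \sum_(w in min_coset_reps n.+1 k.+1) f w =
    \sum_(s in min_coset_reps n k.+1) f (lift_perm ord_max ord_max s) +
    \sum_(s in min_coset_reps n k) f (lift_perm k0 ord_max s).
Proof.
move=> k0k lt_kn; rewrite (bigID (fun w : 'S_n.+1 => w ord_max == ord_max)) /=; congr (_ + _).
  rewrite sum_lift_perm; apply: eq_bigl => s.
  by rewrite min_coset_reps_lift_max.
rewrite (eq_bigl (fun w : 'S_n.+1 => (w \in min_coset_reps n.+1 k.+1) && (w k0 == ord_max))).
  by rewrite sum_lift_perm; apply: eq_bigl => s; rewrite min_coset_reps_lift_mid.
move=> w; apply: andb_id2l => w_min; apply/idP/eqP => [w_max | wk0].
  pose i := (w^-1)%g ord_max; have wi : w i = ord_max by rewrite permKV.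
  have /orP[/eqP i_n | /eqP i_k] := min_coset_reps_last w_min wi.
    have i_max : i = ord_max by apply: val_inj.
    by move: w_max; rewrite -{1}i_max wi eqxx.
  by rewrite -wi; congr (w _); apply: val_inj; rewrite /= k0k.
apply: contraTneq (lt_kn) => wmax.
have /(congr1 val) /= := perm_inj (etrans wk0 (esym wmax)).
by rewrite k0k => ->; rewrite ltnn.
Qed.

Lemma sum_min_coset_reps_trivial (R : nmodType) (n k : nat) (f : 'S_n -> R) :
  (k == 0%N) || (k == n) -> \sum_(w in min_coset_reps n k) f w = f 1%g.
Proof.
move=> k_triv; rewrite (big_pred1 1%g) // => w; apply/min_coset_repsP/eqP => [mono_w | -> i j].
  have {}mono_w (i j : 'I_n) : (i < j)%N -> (w i < w j)%N.
    by move=> ij; apply: mono_w => //; have := ltn_ord j; lia.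
  have le_w (i : 'I_n) : (i <= w i)%N.
    case: i => i; elim: i => [|i IHi] lt_i //.
    have := mono_w (Ordinal (ltnW lt_i)) (Ordinal lt_i) (ltnSn i).
    by have /= := IHi (ltnW lt_i); lia.
  have ge_w (i : 'I_n) : (w i <= i)%N.
    have [m] := ubnP (n - i)%N; elim: m i => // m IHm i lt_m.
    have [lt_i|ge_i] := ltnP i.+1 n; last by have := ltn_ord (w i); lia.
    have := IHm (Ordinal lt_i); have := mono_w i (Ordinal lt_i) (ltnSn i) => /=.
    by have := ltn_ord i; lia.
  by apply/permP => i; apply: val_inj; rewrite perm1 /=; apply/eqP; rewrite eqn_leq ge_w le_w.
by rewrite !perm1.
Qed.

(** The number of [b < t] with [a + b] even: how [t / 2] is rounded depends on the colour of the
    first box of the row. *)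
Definition half_count (a t : nat) : nat := (t + ~~ odd a)./2.

Lemma half_count_odd (a b t : nat) : odd a = odd b -> half_count a t = half_count b t.
Proof. by rewrite /half_count => ->. Qed.

Lemma sum_even_shift (a t N : nat) :
  (\sum_(b < N) ((b < t) && ~~ odd (a + b)) = half_count a (minn t N))%N.
Proof.
elim: N => [|N IHN]; first by rewrite big_ord0 minn0 /half_count; case: odd.
rewrite big_ord_recr /= IHN /half_count oddD.
case: (ltnP N t) => [lt_Nt | le_tN] /=; last first.
  by rewrite addn0 (minn_idPl (leqW le_tN)).
rewrite (minn_idPr lt_Nt).
by case: (odd a) => /=; lia.
Qed.

(** The parity of [e] gives the colour of the northwest corner of the checkerboard; [e = 0]
    corresponds to [eta]. *)
Definition eta_shift (n : nat) (e k : nat) (w : 'S_n) : nat :=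
  (\sum_(j : 'I_n | (j < k)%N) half_count (e + (k.-1 - j)) (w j - j))%N.

Definition reps_poly (n e k : nat) : {poly int} :=
  \sum_(w in min_coset_reps n k) (-1) ^+ (odd_perm w) * 'X^(eta_shift e k w).

Lemma reps_poly_trivial (n e k : nat) : (k == 0%N) || (k == n) -> reps_poly n e k = 1.
Proof.
move=> k_triv; rewrite /reps_poly sum_min_coset_reps_trivial // odd_perm1 mul1r.
rewrite /eta_shift big1 ?expr0 // => j _; rewrite perm1 subnn /half_count.
by case: odd.
Qed.

(** Either the last position carries the maximum and the diagram is that of [s], or position [k]
    does. Then the top row is full, with [n - k] boxes, and deleting it moves the other rows up by
    one, which swaps the colours. *)
Lemma reps_poly_rec (n e k : nat) : (k < n)%N ->
  reps_poly n.+1 e k.+1 =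
    reps_poly n e k.+1 + (-1) ^+ (n - k) * 'X^(half_count e (n - k)) * reps_poly n e.+1 k.
Proof.
move=> lt_kn; have lt_kn1 : (k < n.+1)%N by apply: ltnW.
rewrite /reps_poly (@sum_min_coset_reps _ n k _ (Ordinal lt_kn1)) //; congr (_ + _).
  apply: eq_bigr => s _; rewrite odd_lift_perm addbb addFb; congr (_ * 'X^_).
  rewrite /eta_shift [LHS]big_mkcond big_ord_recr /= ltnNge lt_kn addn0.
  rewrite [RHS]big_mkcond; apply: eq_bigr => j _ /=.
  have -> : widen_ord (leqnSn n) j = lift ord_max j by apply: val_inj; rewrite [RHS]lift_max.
  by rewrite lift_perm_lift !lift_max.
rewrite big_distrr /=; apply: eq_bigr => s _.
rewrite odd_lift_perm /= signr_addb.
have -> : (-1) ^+ (odd k (+) odd n) = (-1) ^+ (n - k) :> {poly int}.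
  by rewrite -[RHS]signr_odd oddB 1?ltnW // addbC.
rewrite [RHS]mulrACA; congr (_ * _); rewrite -exprD; congr ('X ^+ _).
rewrite /eta_shift (bigD1_ord (Ordinal lt_kn1)) ?ltnS //= lift_perm_id /= subnn addn0.
congr addn; apply: eq_big => [j | j lt_jk] /=; first by rewrite /bump; lia.
have lt_jk' : (j < k)%N by move: lt_jk; rewrite /bump; lia.
rewrite lift_perm_lift lift_max /= /bump leqNgt lt_jk' add0n.
by apply: half_count_odd; rewrite -subn1; congr odd; lia.
Qed.

Lemma reps_poly_shift (n e k : nat) : reps_poly n e.+2 k = reps_poly n e k.
Proof.
apply: eq_bigr => w _; congr (_ * 'X^_); apply: eq_bigr => j _.
by apply: half_count_odd; rewrite !addSn /= negbK.
Qed.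

(** The later entries of the first block need larger values, so [w j] leaves room for them. Hence
    every row of the diagram fits into the [n - k] columns. *)
Lemma min_coset_reps_le (n k : nat) (w : 'S_n) (j : 'I_n) :
  w \in min_coset_reps n k -> (k <= n)%N -> (j < k)%N -> (w j <= n - k + j)%N.
Proof.
move=> /min_coset_repsP mono_w le_kn; have [m] := ubnP (k - j)%N.
elim: m j => // m IHm j lt_m lt_jk.
have [lt_j|ge_j] := ltnP j.+1 k; last by have := ltn_ord (w j); lia.
have lt_jn := leq_trans lt_j le_kn.
have := mono_w j (Ordinal lt_jn) (ltnSn j); have := IHm (Ordinal lt_jn) => /=.
by rewrite lt_j => h1 h2; have := h1 ltac:(lia) isT; have := h2 isT; lia.
Qed.

Lemma eta_shift0 (n k : nat) (w : 'S_n) :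
  (k <= n)%N -> w \in min_coset_reps n k -> eta k w = eta_shift 0 k w.
Proof.
move=> le_kn w_min; rewrite /eta -sum1_card big_mkcond /=.
(* Row [a] from the top is row [k - 1 - a] from the bottom. *)
pose jj (a : 'I_k) := widen_ord le_kn (rev_ord a).
transitivity (\sum_(a < k) \sum_(b < n - k)
  if (a, b) \in [set ab in young_diagram k w | ~~ odd (ab.1 + ab.2)] then 1 else 0)%N.
  by rewrite pair_bigA /=; apply: eq_bigr => -[].
transitivity (\sum_(a < k) half_count a (w (jj a) - jj a))%N.
  apply: eq_bigr => a _.
  have le_w := min_coset_reps_le w_min le_kn (ltn_ord (rev_ord a) : (jj a < k)%N).
  rewrite -[in RHS](@minn_idPl (w (jj a) - jj a) (n - k) _); last by rewrite leq_subLR addnC.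
  rewrite -sum_even_shift; apply: eq_bigr => b _; rewrite !inE /=.
  have -> : [exists j : 'I_n, (a + j == k.-1)%N && (b < w j - j)%N] = (b < w (jj a) - jj a)%N.
    apply/existsP/idP => [[j /andP[/eqP aj]] | lt_b].
      by rewrite (_ : j = jj a) //; apply: val_inj => /=; have := ltn_ord a; lia.
    by exists (jj a); rewrite lt_b andbT /=; have := ltn_ord a; lia.
  by case: (_ && _).
rewrite (reindex_inj rev_ord_inj) /= /eta_shift (big_ord_narrow le_kn).
apply: eq_bigr => a _; rewrite /jj rev_ordK add0n.
by congr half_count; rewrite /= ?subKn //; have := ltn_ord a; lia.
Qed.

Lemma gr_polyE (n k : nat) : (k <= n)%N -> gr_poly n k = (-1) ^+ (k * (n - k)) * reps_poly n 0 k.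
Proof.
move=> le_kn; congr (_ * _); apply: eq_bigr => w w_min.
by rewrite -signr_odd odd_perm_length eta_shift0.
Qed.

(** * Closed form of the generating polynomial *)

(** Up to the factor [(x ^+ 2 - 1) ^+ m] this is the quantum factorial of [m] at [x ^+ 2]. The
    nested powers let [ring] work with [x ^+ m] as an atom. *)
Definition sq_factorial (R : comNzRingType) (x : R) (m : nat) : R :=
  \prod_(i < m) ((x ^+ i.+1) ^+ 2 - 1).

Lemma sq_factorial0 (R : comNzRingType) (x : R) : sq_factorial x 0 = 1.
Proof. by rewrite /sq_factorial big_ord0. Qed.

Lemma sq_factorialS (R : comNzRingType) (x : R) (m : nat) :
  sq_factorial x m.+1 = sq_factorial x m * ((x ^+ m.+1) ^+ 2 - 1).
Proof. by rewrite /sq_factorial big_ord_recr. Qed.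

(** With [j = k./2] and [l = m./2], the quotient [c / d] is the Gaussian binomial [j + l] choose
    [j] at [x ^+ 2]; [a] and [b] are the generating functions of the two colourings of a
    [k] by [m] rectangle. *)
Definition checkerboard_form (R : comNzRingType) (x a b : R) (k m : nat) : Prop :=
  let j := k./2 in let l := m./2 in
  let d := sq_factorial x j * sq_factorial x l in
  let c := sq_factorial x (j + l) in
  match odd k, odd m with
  | false, false => d * a = c /\ (1 + x ^+ (j + l)) * (d * b) = (x ^+ j + x ^+ l) * c
  | false, true => d * a = c /\ d * b = x ^+ j * c
  | true, false => d * a = c /\ d * b = x ^+ l * c
  | true, true => d * a = (1 - x ^+ (j + l).+1) * c /\ d * b = 0
  end.

Lemma checkerboard_form_col0 (R : comNzRingType) (x : R) (m : nat) :
  checkerboard_form x 1 1 0 m.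
Proof.
rewrite /checkerboard_form /= sq_factorial0 add0n expr0.
by case: odd; split; ring.
Qed.

Lemma checkerboard_form_row0 (R : comNzRingType) (x : R) (k : nat) :
  checkerboard_form x 1 1 k 0.
Proof.
rewrite /checkerboard_form /= sq_factorial0 addn0 expr0.
by case: odd; split; ring.
Qed.

Lemma half_doubleE (j : nat) :
  (odd j.*2 = false) * (odd j.*2.+1 = true) * (odd j.*2.+2 = false) * (odd j.*2.+3 = true) *
  (j.*2./2 = j) * (j.*2.+1./2 = j) * (j.*2.+2./2 = j.+1) * (j.*2.+3./2 = j.+1).
Proof. by do !split; lia. Qed.

Lemma half_countE (t : nat) : (half_count 0 t = t.+1./2) * (half_count 1 t = t./2).
Proof. by rewrite /half_count addn1 addn0. Qed.

(** The recurrence swaps the colourings, so [a] picks up [b'] and [b] picks up [a']. For fixed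
    parities, generalising powers and factorials turns each claim into a ring identity; [nz] cancels
    the factor [1 + x ^+ i] that an even-even input carries. *)
Lemma checkerboard_form_step (R : idomainType) (x a b a' b' : R) (k m : nat) :
  (forall i, 1 + x ^+ i != 0) ->
  checkerboard_form x a b k.+1 m -> checkerboard_form x a' b' k m.+1 ->
  checkerboard_form x (a + (-1) ^+ m.+1 * x ^+ half_count 0 m.+1 * b')
                      (b + (-1) ^+ m.+1 * x ^+ half_count 1 m.+1 * a') k.+1 m.+1.
Proof.
move=> x1_neq0; rewrite /checkerboard_form !half_countE -[(-1) ^+ _]signr_odd.
rewrite -(odd_double_half k) -(odd_double_half m).
move: (k./2) (m./2) => j l; have := x1_neq0 (j + l).+1.
case: (odd k); case: (odd m); rewrite ?add1n ?add0n !half_doubleE ?addSn ?addnS ?sq_factorialS;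
  rewrite ?expr0 ?expr1 !(exprS x) exprD;
  move: (x ^+ j) (x ^+ l) (sq_factorial x j) (sq_factorial x l)
    (sq_factorial x (j + l)) => u v Pj Pl P nz [H1 H2] [H3 H4].
- split; [transitivity ((Pj * ((x * u) ^+ 2 - 1) * Pl * a) * ((x * v) ^+ 2 - 1)
      + x * v * ((x * u) ^+ 2 - 1) * (Pj * (Pl * ((x * v) ^+ 2 - 1)) * b')); first by ring
    | transitivity ((1 + x * (x * (u * v))) *
      ((Pj * ((x * u) ^+ 2 - 1) * Pl * b) * ((x * v) ^+ 2 - 1)
      + x * v * ((x * u) ^+ 2 - 1) * (Pj * (Pl * ((x * v) ^+ 2 - 1)) * a'))); first by ring].
    by rewrite H1 H4; ring.
  by rewrite H2 H3; ring.
- split; first by transitivity ((Pj * ((x * u) ^+ 2 - 1) * Pl * a)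
      - x * v * ((x * u) ^+ 2 - 1) * (Pj * Pl * b')); [ring | rewrite H1 H4; ring].
  apply: (mulfI nz); transitivity ((1 + x * (u * v)) * (Pj * ((x * u) ^+ 2 - 1) * Pl * b)
      - (1 + x * (u * v)) * v * ((x * u) ^+ 2 - 1) * (Pj * Pl * a')); first by ring.
  by rewrite H2 H3; ring.
- split; last by transitivity ((Pj * Pl * b) * ((x * v) ^+ 2 - 1)
      + x * v * (Pj * (Pl * ((x * v) ^+ 2 - 1)) * a')); [ring | rewrite H2 H3; ring].
  apply: (mulfI nz); transitivity ((1 + x * (u * v)) * (Pj * Pl * a) * ((x * v) ^+ 2 - 1)
      + x * v * ((1 + x * (u * v)) * (Pj * (Pl * ((x * v) ^+ 2 - 1)) * b'))); first by ring.
  by rewrite H4 -[_ * (Pj * Pl * a)]mulrC H1; ring.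
- by split; [transitivity ((Pj * Pl * a) - x * v * (Pj * Pl * b'))
    | transitivity ((Pj * Pl * b) - v * (Pj * Pl * a'))];
    first [ring | rewrite ?H1 ?H2 ?H3 ?H4; ring].
Qed.

Lemma reps_poly_form (k m : nat) :
  checkerboard_form 'X (reps_poly (k + m) 0 k) (reps_poly (k + m) 1 k) k m.
Proof.
have X1_neq0 i : 1 + 'X^i != 0 :> {poly int}.
  (* At 1 this polynomial takes the value 2. *)
  apply/eqP => /(congr1 (fun p => p.[1])) /eqP.
  by rewrite hornerD hornerXn hornerC expr1n horner0.
elim: k m => [|k IHk] m.
  by rewrite !reps_poly_trivial //; apply: checkerboard_form_col0.
elim: m => [|m IHm].
  by rewrite !reps_poly_trivial ?addn0 ?eqxx ?orbT //; apply: checkerboard_form_row0.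
have lt_k : (k < k + m.+1)%N by rewrite addnS ltnS leq_addr.
rewrite addSn !reps_poly_rec // !addKn reps_poly_shift.
rewrite addnS -addSn; apply: checkerboard_form_step X1_neq0 IHm _.
by rewrite addSnnS; apply: IHk.
Qed.

Lemma monicXn_sub1 (R : idomainType) (m : nat) : ('X^(m.+1) - 1 : {poly R}) \is monic.
Proof. by rewrite -polyC1 monicXnsubC. Qed.

Lemma size_Xn_sub1 (R : idomainType) (m : nat) : size ('X^(m.+1) - 1 : {poly R}) = m.+2.
Proof. by rewrite -polyC1 size_XnsubC. Qed.

Lemma sq_factorial_monic (R : idomainType) (m : nat) :
  sq_factorial ('X : {poly R}) m \is monic.
Proof. by apply: monic_prod => i _; rewrite -exprM mulSn monicXn_sub1. Qed.

Lemma size_sq_factorial (R : idomainType) (m : nat) :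
  size (sq_factorial ('X : {poly R}) m) = (m * m.+1).+1.
Proof.
elim: m => [|m IHm]; first by rewrite sq_factorial0 size_poly1.
rewrite sq_factorialS -exprM mulSn size_Mmonic ?monicXn_sub1 ?monic_neq0 ?sq_factorial_monic //.
by rewrite size_Xn_sub1 IHm; lia.
Qed.

(** The common value to which the polynomial side and the point count are both reduced, after
    clearing the denominator [sq_factorial x k./2 * sq_factorial x m./2]. *)
Definition gr_count (R : comNzRingType) (x : R) (k m : nat) : R :=
  let j := k./2 in let l := m./2 in
  x ^+ (j * l).*2 * sq_factorial x (j + l) *
  match odd k, odd m with
  | false, false => 1
  | false, true => x ^+ j.*2
  | true, false => x ^+ l.*2
  | true, true => x ^+ (j + l) * (x ^+ (j + l).+1 - 1)
  end.

(** In the identity [dp] all factors other than [p] are monic, so the degree of [p] is found by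
    subtraction. For [k] and [m] both odd, the sign in [gr_poly] turns [1 - 'X^i] into the monic
    [c]. *)
Lemma gr_poly_count (k m : nat) (q : int) :
  let p := gr_poly (k + m) k in
  sq_factorial q k./2 * sq_factorial q m./2 * (q ^+ (k * m - (size p).-1) * p.[q]) =
  gr_count q k m.
Proof.
move=> /=; move Ep : (gr_poly (k + m) k) => p.
set d := sq_factorial 'X k./2 * sq_factorial 'X m./2 : {poly int}.
pose c : {poly int} := if odd k && odd m then 'X^((k./2 + m./2).+1) - 1 else 1.
have dp : d * p = c * sq_factorial 'X (k./2 + m./2).
  have dr : d * reps_poly (k + m) 0 k =
      (if odd k && odd m then -1 else 1) * c * sq_factorial 'X (k./2 + m./2).
    have := reps_poly_form k m; rewrite /checkerboard_form -/d /c.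
    by case: (odd k); case: (odd m) => -[-> _] /=; ring.
  rewrite -Ep gr_polyE ?leq_addr // addKn -signr_odd oddM mulrCA dr.
  by case: (odd k && odd m); ring.
have d_monic : d \is monic by rewrite monicMl ?sq_factorial_monic.
have c_monic : c \is monic.
  by rewrite /c; case: (_ && _); [apply: monicXn_sub1 | apply: monic1].
have p_neq0 : p != 0.
  apply: contraTneq (isT) => p0; move: dp; rewrite p0 mulr0 => /esym/eqP.
  by rewrite (negbTE (mulf_neq0 (monic_neq0 c_monic) (monic_neq0 (sq_factorial_monic _ _)))).
have size_c : size c = if odd k && odd m then (k./2 + m./2).+2 else 1%N.
  by rewrite /c; case: (_ && _); rewrite ?size_Xn_sub1 ?size_poly1.
have size_d : size d = (k./2 * k./2.+1 + m./2 * m./2.+1).+1.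
  by rewrite size_Mmonic ?monic_neq0 ?sq_factorial_monic // !size_sq_factorial; lia.
have size_p : (size p).-1 = ((k./2 * m./2).*2 + if odd k && odd m then (k./2 + m./2).+1 else 0)%N.
  have := congr1 (fun r : {poly int} => size r) dp.
  rewrite /= [d * p]mulrC (size_Mmonic p_neq0 d_monic).
  rewrite (size_Mmonic (monic_neq0 c_monic) (sq_factorial_monic _ _)).
  rewrite size_sq_factorial size_c size_d; have := size_poly_eq0 p; rewrite (negbTE p_neq0).
  move: (size p) (k./2) (m./2) => s j l.
  by case: (_ && _); rewrite !mulnS !mulnDl !mulnDr -muln2 (mulnC l j); lia.
have horner_sq n : (sq_factorial 'X n : {poly int}).[q] = sq_factorial q n.
  by rewrite /sq_factorial horner_prod; apply: eq_bigr => i _; rewrite !hornerE.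
have dq : sq_factorial q k./2 * sq_factorial q m./2 * p.[q] =
    (if odd k && odd m then q ^+ (k./2 + m./2).+1 - 1 else 1) * sq_factorial q (k./2 + m./2).
  transitivity ((d * p).[q]); first by rewrite hornerM; congr (_ * _); rewrite hornerM !horner_sq.
  by rewrite dp hornerM horner_sq /c; case: (_ && _); rewrite !hornerE.
rewrite mulrCA {}dq {}size_p {dp c c_monic size_c d d_monic size_d p_neq0} /gr_count.
rewrite -(odd_double_half k) -(odd_double_half m).
move: (k./2) (m./2) => j l.
(* The number of boxes minus the degree of [p], in the four parity cases. *)
have r00 : (j.*2 * l.*2 - ((j * l).*2 + 0) = (j * l).*2)%N by nia.
have r01 : (j.*2 * l.*2.+1 - ((j * l).*2 + 0) = (j * l).*2 + j.*2)%N by nia.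
have r10 : (j.*2.+1 * l.*2 - ((j * l).*2 + 0) = (j * l).*2 + l.*2)%N by nia.
have r11 : (j.*2.+1 * l.*2.+1 - ((j * l).*2 + (j + l).+1) = (j * l).*2 + (j + l))%N by nia.
case: (odd k); case: (odd m); rewrite ?add1n ?add0n !half_doubleE.
- by rewrite r11 exprD /=; ring.
- by rewrite r10 exprD /=; ring.
- by rewrite r01 exprD /=; ring.
- by rewrite r00 /=; ring.
Qed.

(** * Quadratic forms and orthogonal projections *)

Lemma form_unitmx (F : fieldType) (n : nat) (S T A : 'M[F]_n) :
  T \in unitmx -> A *m S *m A^T = T -> A \in unitmx.
Proof. by move=> T_unit AS; move: T_unit; rewrite -AS !unitmx_mul => /andP[/andP[]]. Qed.

Lemma form_sym (F : fieldType) (m n : nat) (S : 'M[F]_n) (A : 'M_(m, n)) :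
  S^T = S -> (A *m S *m A^T)^T = A *m S *m A^T.
Proof. by move=> S_sym; rewrite !trmx_mul trmxK S_sym mulmxA. Qed.

(** Polarisation: if all values vanish, those at sums of two basis vectors give [2 * S i j = 0]. *)
Lemma anisotropic_vector (F : fieldType) (n : nat) (S : 'M[F]_n) :
  (2%:R : F) != 0 -> S^T = S -> S != 0 -> exists v : 'rV_n, (v *m S *m v^T) 0 0 != 0.
Proof.
move=> two_neq0 S_sym; apply: contra_neqP => /forallNP S_iso.
have qf_delta (i j : 'I_n) : ((delta_mx 0 i : 'rV_n) *m S *m (delta_mx 0 j : 'rV_n)^T) 0 0 = S i j.
  by rewrite trmx_delta -rowE -colE !mxE.
have diag0 i : S i i = 0 by rewrite -qf_delta; apply/eqP/negPn/negP/S_iso.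
apply/matrixP => i j; rewrite mxE; apply/eqP.
have /negP/negPn := S_iso (delta_mx 0 i + delta_mx 0 j).
rewrite linearD /= !mulmxDl !mulmxDr mxE [X in X + _]mxE [X in _ + X]mxE.
rewrite !qf_delta !diag0 add0r addr0.
have -> : S j i = S i j by rewrite -{1}S_sym mxE.
by rewrite -mulr2n -mulr_natl mulf_eq0 (negPf two_neq0).
Qed.

Lemma form_split (F : fieldType) (n : nat) (S : 'M[F]_(1 + n)) (v : 'rV_(1 + n)) (c : F) :
  S^T = S -> S \in unitmx -> v *m S *m v^T = c%:M -> c != 0 ->
  exists (A : 'M_(1 + n)) (S' : 'M_n),
    [/\ A *m S *m A^T = block_mx c%:M 0 0 S', S'^T = S' & S' \in unitmx].
Proof.
move=> S_sym S_unit vSv c_neq0.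
(* [B] is a basis of the orthogonal complement of [v], of dimension [n] because [S *m v^T] is
   nonzero. *)
have [B freeB BSv] : exists2 B : 'M_(n, 1 + n), row_free B & B *m (S *m v^T) = 0.
  have rk1 : \rank (S *m v^T) = 1%N.
    apply/eqP; rewrite eqn_leq rank_leq_col lt0n mxrank_eq0.
    apply: contraNneq c_neq0 => Sv0; move: vSv; rewrite -mulmxA Sv0 mulmx0 => /matrixP/(_ 0 0).
    by rewrite !mxE eqxx mulr1n => <-.
  have rk : \rank (kermx (S *m v^T)) = n by rewrite mxrank_ker rk1 subn1.
  have := row_base_free (kermx (S *m v^T)); have := eq_row_base (kermx (S *m v^T)).
  move: (row_base _); rewrite rk => B eqB freeB; exists B => //.
  by apply/sub_kermxP; rewrite eqB.
pose A := col_mx v B.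
have vSB : v *m S *m B^T = 0.
  by apply: trmx_inj; rewrite !trmx_mul trmxK S_sym BSv trmx0.
have AS : A *m S *m A^T = block_mx c%:M 0 0 (B *m S *m B^T).
  by rewrite /A tr_col_mx mul_col_mx mul_col_row vSv vSB -[B *m S *m v^T]mulmxA BSv.
(* Pairing a relation between the rows with [v] kills the [B] part, so, as [c != 0], the coefficient
   of [v] is zero. *)
have A_unit : A \in unitmx.
  rewrite -row_free_unit; apply: inj_row_free => w.
  rewrite -[w]hsubmxK mul_row_col => wA.
  have /(congr1 (fun x => x *m (S *m v^T))) := wA.
  rewrite mulmxDl -!mulmxA BSv mulmx0 addr0 mul0mx (mulmxA v) vSv mul_mx_scalar => /eqP.
  rewrite scaler_eq0 (negPf c_neq0) /= => /eqP l0.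
  move: wA; rewrite l0 mul0mx add0r => /eqP; rewrite mulmx_free_eq0 // => /eqP ->.
  by rewrite row_mx0.
exists A, (B *m S *m B^T); split => //; first exact: form_sym.
have : A *m S *m A^T \in unitmx by rewrite !unitmx_mul unitmx_tr A_unit S_unit.
by rewrite AS !unitmxE det_ublock det_scalar1 unitrM => /andP[].
Qed.

Lemma form_block_mul (F : fieldType) (n : nat) (c : F) (S : 'M[F]_(1 + n)) (A : 'M_(1 + n))
    (S' B : 'M_n) (a : F) :
  A *m S *m A^T = block_mx c%:M 0 0 S' ->
  let C := block_mx a%:M 0 0 B *m A in
  C *m S *m C^T = block_mx (a * c * a)%:M 0 0 (B *m S' *m B^T).
Proof.
move=> AS C; rewrite /C trmx_mul mulmxA -(mulmxA _ A S) -(mulmxA _ (A *m S)) AS.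
rewrite tr_block_mx !mulmx_block !(mulmx0, mul0mx, addr0, add0r, trmx0) tr_scalar_mx.
by rewrite -!scalar_mxM.
Qed.

Lemma form_closed (F : closedFieldType) (n : nat) (S : 'M[F]_n) :
  (2%:R : F) != 0 -> S^T = S -> S \in unitmx -> exists A : 'M_n, A *m S *m A^T = 1%:M.
Proof.
move=> two_neq0; elim: n S => [|n IHn] S S_sym S_unit.
  by exists 1%:M; apply/matrixP => -[].
have S_neq0 : S != 0 by apply: contraTneq S_unit => ->; rewrite unitmxE det0 unitr0.
have [v vSv] := anisotropic_vector two_neq0 S_sym S_neq0.
have [A [S' [AS S'_sym S'_unit]]] := @form_split _ n S v _ S_sym S_unit (mx11_scalar _) vSv.
have [B BS'] := IHn S' S'_sym S'_unit.
(* The coefficient list encodes [x ^+ 2 = c^-1], where [c] is the value at [v]; scaling by [x] makes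
   [v] a unit vector. *)
have [x] := @solve_monicpoly F 2 (nth 0 [:: ((v *m S *m v^T) 0 0)^-1; 0]) isT.
rewrite !big_ord_recr big_ord0 /= expr0 mulr1 mul0r add0r addr0 => xx.
exists (block_mx x%:M 0 0 B *m A); rewrite (form_block_mul _ _ AS) BS'.
by rewrite mulrAC -expr2 xx mulVf // -scalar_mx_block.
Qed.

(** [g] is the reflection in the hyperplane orthogonal to [u], acting on row vectors from the
    right. *)
Lemma reflection_form (F : fieldType) (n : nat) (S : 'M[F]_n) (u : 'rV_n) (c : F) :
  S^T = S -> u *m S *m u^T = c%:M -> c != 0 ->
  let g := 1%:M - (2%:R / c) *: (S *m u^T *m u) in g *m S *m g^T = S.
Proof.
move=> S_sym uSu c_neq0 g.
pose t := 2%:R / c; have tc : t * c = 2%:R by rewrite divfK.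
have tr_g : g^T = 1%:M - t *: (u^T *m (u *m S)).
  by rewrite /g raddfB /= trmx1 linearZ /= !trmx_mul trmxK S_sym.
have gS : g *m S = S - t *: (S *m u^T *m (u *m S)).
  by rewrite /g mulmxBl mul1mx -scalemxAl -!mulmxA.
rewrite gS tr_g mulmxBr mulmx1 mulmxBl -!scalemxAr -!scalemxAl.
have -> : S *m u^T *m (u *m S) *m (u^T *m (u *m S)) = c *: (S *m u^T *m (u *m S)).
  rewrite (mulmxA _ u^T) -(mulmxA _ (u *m S) u^T) uSu.
  by rewrite mul_mx_scalar -scalemxAl.
rewrite !mulmxA; move: (S *m u^T *m u *m S) => M.
rewrite !scalerA -(mulrA t) tc mulr_natr mulr2n scalerDl opprB.
by rewrite addrK subrK.
Qed.

(** The reflection along [e - v] sends [e] to [v] unless [e - v] is isotropic. *)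
Lemma unit_vector_transitive (F : fieldType) (n : nat) (S : 'M[F]_n) (e v : 'rV_n) :
  (2%:R : F) != 0 -> S^T = S -> e *m S *m e^T = 1%:M -> v *m S *m v^T = 1%:M ->
  exists g, g *m S *m g^T = S /\ e *m g = v.
Proof.
move=> two_neq0 S_sym eSe; pose b (x y : 'rV_n) := (x *m S *m y^T) 0 0.
have bE x y : x *m S *m y^T = (b x y)%:M by apply: mx11_scalar.
have bDl x y z : b (x + y) z = b x z + b y z by rewrite /b !mulmxDl mxE.
have bNl x y : b (- x) y = - b x y by rewrite /b !mulNmx mxE.
have bC x y : b x y = b y x.
  by rewrite /b -[x *m S *m y^T]trmxK [LHS]mxE !trmx_mul trmxK S_sym mulmxA.
have bDr x y z : b x (y + z) = b x y + b x z by rewrite bC bDl !(bC x).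
have bNr x y : b x (- y) = - b x y by rewrite bC bNl bC.
have b1 x : x *m S *m x^T = 1%:M -> b x x = 1 by rewrite /b => ->; rewrite mxE.
(* The values at [e - v] and [e + v] add up to 4, so they do not both vanish. In the isotropic case
   [e] is sent to [- v] and the isometry is negated. *)
wlog uu : v / b (e - v) (e - v) != 0.
  move=> wlg vSv; have [uu|uu] := eqVneq (b (e - v) (e - v)) 0; last exact: wlg.
  have [||g [gS eg]] := wlg (- v).
  - apply: contraNneq two_neq0 => ww; have : (2%:R : F) * 2%:R = 0.
      transitivity (b (e - v) (e - v) + b (e - - v) (e - - v)); last by rewrite uu ww addr0.
      by rewrite !(bDl, bNl, bDr, bNr) (bC v e) !b1 //; ring.
    by move/eqP; rewrite mulf_eq0 orbb.
  - by rewrite linearN /= mulNmx mulmxN mulNmx opprK.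
  by exists (- g); rewrite [(- g)^T]linearN /= !(mulNmx, mulmxN) opprK eg opprK.
move=> vSv; exists (1%:M - (2%:R / b (e - v) (e - v)) *: (S *m (e - v)^T *m (e - v))).
split; first exact: reflection_form.
have bu : b (e - v) (e - v) = 2%:R * b e (e - v).
  by rewrite !(bDl, bNl, bDr, bNr) (bC v e) !b1 //; ring.
rewrite mulmxBr mulmx1 -scalemxAr !mulmxA bE mul_scalar_mx scalerA.
by rewrite mulrAC -bu divff // scale1r subKr.
Qed.

(** These are the orthogonal projections for the standard form; by [sym_idempotent_gram_unit] their
    row spaces are nondegenerate. *)
Definition sym_idempotent (F : fieldType) (n : nat) (Q : 'M[F]_n) : bool :=
  (Q^T == Q) && (Q *m Q == Q).

(** If [w *m V] is orthogonal to the rows of [V], the symmetric [Q] kills it; but [Q] also fixes it,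
    so it is zero. *)
Lemma sym_idempotent_gram_unit (F : fieldType) (k n : nat) (Q : 'M[F]_n) (V : 'M_(k, n)) :
  sym_idempotent Q -> row_free V -> (V :=: Q)%MS -> V *m Q = V /\ V *m V^T \in unitmx.
Proof.
move=> /andP[/eqP Q_sym /eqP QQ] freeV eqVQ.
have /submxP[B VB] : (V <= Q)%MS by rewrite eqVQ.
have /submxP[C QC] : (Q <= V)%MS by rewrite eqVQ.
have VQ : V *m Q = V by rewrite VB -mulmxA QQ.
split=> //; rewrite -row_free_unit; apply: inj_row_free => w wVV.
apply/eqP; rewrite -(mulmx_free_eq0 _ freeV) -VQ mulmxA -Q_sym QC trmx_mul mulmxA.
by rewrite -[w *m V *m V^T]mulmxA wVV mul0mx.
Qed.

(** Both matrices project onto the row space of [X], so [Q *m Q' = Q] and [Q' *m Q = Q'];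
    transposing the first identity makes them equal. *)
Lemma orthogonal_projection_unique (F : fieldType) (k n : nat) (Q : 'M[F]_n)
    (X : 'M_(k, n)) (D : 'M_k) :
  Q^T = Q -> D \in unitmx -> X *m X^T = D -> X *m Q = X -> (Q <= X)%MS ->
  X^T *m invmx D *m X = Q.
Proof.
move=> Q_sym D_unit XX XQ /submxP[C QC].
have D_sym : D^T = D by rewrite -XX trmx_mul trmxK.
set Q' := X^T *m invmx D *m X.
have Q'_sym : Q'^T = Q' by rewrite /Q' !trmx_mul trmxK trmx_inv D_sym mulmxA.
have QQ' : Q *m Q' = Q.
  by rewrite {1}QC /Q' !mulmxA -[C *m X *m X^T]mulmxA XX mulmxK.
by rewrite -[RHS]Q_sym -QQ' trmx_mul Q_sym Q'_sym -mulmxA XQ.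
Qed.

Lemma sym_idempotent_orthogonal_projection (F : fieldType) (k n : nat) (X : 'M[F]_(k, n))
    (D : 'M_k) :
  D \in unitmx -> X *m X^T = D ->
  let Q := X^T *m invmx D *m X in [/\ sym_idempotent Q, \rank Q = k & X *m Q = X].
Proof.
move=> D_unit XX Q.
have D_sym : D^T = D by rewrite -XX trmx_mul trmxK.
have XQ : X *m Q = X by rewrite /Q !mulmxA XX mulmxV // mul1mx.
split=> //.
  by rewrite /sym_idempotent {1 3}/Q -[_ *m X *m Q]mulmxA XQ eqxx andbT /Q !trmx_mul trmxK
    trmx_inv D_sym mulmxA.
apply/eqP; rewrite eqn_leq (leq_trans (mxrankM_maxr _ _) (rank_leq_row X)) /=.
rewrite -{1}(mxrank_unit D_unit) -XX (leq_trans (mxrankM_maxl _ _)) //.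
by rewrite -{1}XQ mxrankM_maxr.
Qed.

Lemma sym_idempotent_basis (F : fieldType) (k n : nat) (Q : 'M[F]_n) :
  \rank Q = k -> exists2 V : 'M_(k, n), row_free V & (V :=: Q)%MS.
Proof.
by move=> <-; exists (row_base Q); [apply: row_base_free | apply: eq_row_base].
Qed.

Lemma sym_idempotent_compl (F : fieldType) (n : nat) (Q : 'M[F]_n) :
  sym_idempotent Q -> sym_idempotent (1%:M - Q) /\ \rank (1%:M - Q) = (n - \rank Q)%N.
Proof.
move=> /andP[/eqP Q_sym /eqP QQ]; split.
  rewrite /sym_idempotent linearB /= trmx1 Q_sym eqxx /= mulmxBl mul1mx mulmxBr mulmx1 QQ.
  by rewrite subrr subr0.
rewrite -mxrank_ker; apply: eqmx_rank; apply/andP; split.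
  by apply/sub_kermxP; rewrite mulmxBl mul1mx QQ subrr.
apply/submxP; exists (kermx Q); rewrite mulmxBr mulmx1.
by rewrite mulmx_ker subr0.
Qed.

(** Over a closed field the row spaces of [Q] and [1%:M - Q] have orthonormal bases; stacked, they
    form the orthogonal matrix [g]. *)
Lemma sym_idempotent_closed (F : closedFieldType) (k m : nat) (Q : 'M[F]_(k + m)) :
  (2%:R : F) != 0 -> sym_idempotent Q -> \rank Q = k ->
  exists2 g : 'M_(k + m), g *m g^T = 1%:M & g^T *m block_mx 1%:M 0 0 0 *m g = Q.
Proof.
move=> two_neq0 Q_idem rkQ.
have orthonormal r (P : 'M[F]_(k + m)) : sym_idempotent P -> \rank P = r ->
    exists2 X : 'M_(r, k + m), X *m X^T = 1%:M & X *m P = X /\ X^T *m X = P.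
  move=> P_idem rkP; have [V freeV eqVP] := sym_idempotent_basis rkP.
  have [VP VV_unit] := sym_idempotent_gram_unit P_idem freeV eqVP.
  have VV_sym : (V *m V^T)^T = V *m V^T by rewrite trmx_mul trmxK.
  have [A AVVA] := form_closed two_neq0 VV_sym VV_unit.
  have A_unit : A \in unitmx by apply: form_unitmx AVVA; apply: unitmx1.
  exists (A *m V); first by rewrite trmx_mul !mulmxA -(mulmxA A) AVVA.
  have AVP : A *m V *m P = A *m V by rewrite -mulmxA VP.
  split=> //; have /andP[/eqP P_sym _] := P_idem.
  rewrite -(@orthogonal_projection_unique _ _ _ P (A *m V) 1%:M) ?unitmx1 //.
  - by rewrite invmx1 mulmx1.
  - by rewrite trmx_mul !mulmxA -(mulmxA A) AVVA.
  - by rewrite -eqVP -[X in (X <= _)%MS](mulKmx A_unit) submxMl.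
have [V VV [VQ VTV]] := orthonormal k Q Q_idem rkQ.
have [Q'_idem rkQ'] := sym_idempotent_compl Q_idem.
have rkm : \rank (1%:M - Q) = m by rewrite rkQ' rkQ addKn.
have [W WW [WQ' WTW]] := orthonormal m _ Q'_idem rkm.
have WQ : W *m Q = 0.
  by move: WQ'; rewrite mulmxBr mulmx1 -[X in _ = X]subr0 => /addrI/oppr_inj.
have /andP[/eqP Q_sym _] := Q_idem.
have WV : W *m V^T = 0 by rewrite -VQ trmx_mul Q_sym mulmxA WQ mul0mx.
have VW : V *m W^T = 0 by apply: trmx_inj; rewrite trmx_mul trmxK WV trmx0.
exists (col_mx V W).
  by rewrite tr_col_mx mul_col_row VV WW VW WV -scalar_mx_block.
by rewrite tr_col_mx mul_row_block !(mulmx0, mulmx1, addr0) mul_row_col mul0mx addr0.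
Qed.

(** * Counting frames over a finite field *)

Lemma form_mul (R : comNzRingType) (k m n : nat) (A : 'M[R]_(k, m)) (B : 'M_(m, n)) (S : 'M_n) :
  A *m B *m S *m (A *m B)^T = A *m (B *m S *m B^T) *m A^T.
Proof. by rewrite trmx_mul !mulmxA. Qed.

Definition frames (F : finFieldType) (k n : nat) (T : 'M[F]_k) (S : 'M[F]_n) : {set 'M[F]_(k, n)} :=
  [set X | X *m S *m X^T == T].

(** The first vector is a unit vector [v]. An isometry moving it back to [e] leaves the other
    vectors in the complement of [e], where the form is [S]; so the number of completions does not
    depend on [v]. *)
Lemma card_frames_block (F : finFieldType) (k n : nat) (T : 'M[F]_k) (S : 'M[F]_n) :
  (2%:R : F) != 0 -> S^T = S -> S \in unitmx ->
  let S1 : 'M_(1 + n) := block_mx 1%:M 0 0 S in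
  let T1 : 'M_(1 + k) := block_mx 1%:M 0 0 T in
  #|frames T1 S1| = (#|frames (1%:M : 'M_1) S1| * #|frames T S|)%N.
Proof.
move=> two_neq0 S_sym S_unit S1 T1.
have S1_sym : S1^T = S1 by rewrite /S1 tr_block_mx trmx1 !trmx0 S_sym.
have S1_unit : S1 \in unitmx by rewrite unitmxE det_ublock det1 mul1r -unitmxE.
pose e : 'rV[F]_(1 + n) := row_mx 1%:M 0.
have eS1 : e *m S1 = e by rewrite /e mul_row_block !(mul0mx, mulmx0, addr0, mulmx1).
have ee : e *m e^T = 1%:M by rewrite /e tr_row_mx mul_row_col trmx1 mulmx1 mul0mx addr0.
have eSe : e *m S1 *m e^T = 1%:M by rewrite eS1.
(* A chosen isometry taking [e] to [v]; by [gP] the default is not reached on unit vectors. *)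
pose g (v : 'rV[F]_(1 + n)) : 'M_(1 + n) :=
  odflt 1%:M [pick h | (h *m S1 *m h^T == S1) && (e *m h == v)].
have gP v : v \in frames (1%:M : 'M_1) S1 -> g v *m S1 *m (g v)^T = S1 /\ e *m g v = v.
  rewrite inE => /eqP vSv; rewrite /g; case: pickP => [h /andP[/eqP ? /eqP ?] //|none].
  have [h [hS eh]] := unit_vector_transitive two_neq0 S1_sym eSe vSv.
  by have := none h; rewrite hS eh !eqxx.
have g_unit v : v \in frames (1%:M : 'M_1) S1 -> g v \in unitmx.
  by move=> /gP[gS _]; apply: form_unitmx gS.
pose f (vY : 'rV[F]_(1 + n) * 'M[F]_(k, n)) : 'M_(1 + k, 1 + n) :=
  block_mx 1%:M 0 0 vY.2 *m g vY.1.
have f_u v Y : v \in frames (1%:M : 'M_1) S1 -> usubmx (f (v, Y)) = v.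
  by move=> /gP[_ gv]; rewrite /f /block_mx mul_col_mx col_mxKu.
rewrite -cardsX -(card_in_imset (f := f)); last first.
  move=> [v Y] [v' Y'] /setXP[/= v_in _] /setXP[/= v'_in _] fE.
  have vv' : v = v' by rewrite -(f_u v Y) // fE f_u.
  move: fE; rewrite -{}vv' /f /= => /(congr1 (mulmx^~ (invmx (g v)))).
  by rewrite !mulmxK ?g_unit // => /eq_block_mx[_ _ _ ->].
apply: eq_card => X; apply/idP/imsetP => [|[[v Y] /setXP[/= v_in Y_in] ->]]; last first.
  rewrite inE /f /= form_mul; have [-> _] := gP v v_in.
  rewrite tr_block_mx !trmx0 trmx1 !mulmx_block !(mul0mx, mulmx0, addr0, add0r, mulmx1).
  by move: Y_in; rewrite inE => /eqP ->.
rewrite inE => /eqP XSX; pose v := usubmx X.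
have v_in : v \in frames (1%:M : 'M_1) S1.
  rewrite inE /v; apply/eqP; have := congr1 ulsubmx XSX.
  by rewrite -{1 2}[X]vsubmxK tr_col_mx mul_col_mx mul_col_row !block_mxKul.
have [gS eg] := gP v v_in; have gu := g_unit v v_in.
have [Z XZ] : exists Z, X = Z *m g v by exists (X *m invmx (g v)); rewrite mulmxKV.
have ZSZ : Z *m S1 *m Z^T = T1.
  by rewrite -XSX XZ form_mul gS.
have Zu : usubmx Z = e.
  by apply: (can_inj (mulmxK gu)); rewrite eg mul_usub_mx -XZ.
have ZE : Z = col_mx e (row_mx (dlsubmx Z) (drsubmx Z)).
  by rewrite -Zu hsubmxK vsubmxK.
move: ZSZ; rewrite ZE tr_col_mx mul_col_mx mul_col_row eS1.
rewrite /e !tr_row_mx !mul_row_block !mul_row_col trmx1 trmx0.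
rewrite !(mul0mx, mulmx0, addr0, add0r, mulmx1) => /eq_block_mx[_ _ dl0].
rewrite dl0 mul0mx add0r => YSY; exists (v, drsubmx Z); first by rewrite inE /= v_in inE YSY eqxx.
by rewrite /f /= [LHS]XZ; congr (_ *m _); rewrite [LHS]ZE dl0.
Qed.

(** * Sizes of spheres *)

Definition level (F : finFieldType) (n : nat) (S : 'M[F]_n) (a : F) : nat :=
  #|frames (a%:M : 'M_1) S|.

Lemma sum_level (F : finFieldType) (n : nat) (S : 'M[F]_n) : (\sum_a level S a = #|F| ^ n)%N.
Proof.
transitivity #|{: 'rV[F]_n}|; last by rewrite card_mx mul1n.
rewrite -sum1_card (partition_big (fun v : 'rV_n => (v *m S *m v^T) 0 0) xpredT) //=.
apply: eq_bigr => a _; rewrite /level -sum1_card; apply: eq_bigl => v.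
rewrite !inE; apply/eqP/eqP => [/matrixP/(_ 0 0) | <-]; last exact: mx11_scalar.
by rewrite [in RHS]mxE eqxx mulr1n.
Qed.

Lemma level_block (F : finFieldType) (n : nat) (S : 'M[F]_n) (a : F) :
  level (block_mx (1%:M : 'M_1) 0 0 S) a = (\sum_(x : F) level S (a - x ^+ 2)%R)%N.
Proof.
rewrite {1}/level -sum1_card (reindex (fun p : F * 'rV[F]_n => row_mx p.1%:M p.2 : 'rV_(1 + n))) /=.
  transitivity (\sum_(x : F) \sum_(w in frames ((a - x ^+ 2)%R%:M : 'M_1) S) 1)%N; last first.
    by apply: eq_bigr => x _; rewrite sum1_card.
  rewrite pair_big_dep.
  apply: eq_bigl => -[x w]; rewrite !inE mul_row_block tr_row_mx mul_row_col.
  rewrite !(mulmx0, mulmx1, addr0, add0r) tr_scalar_mx -scalar_mxM -expr2.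
  by rewrite raddfB [RHS]eq_sym subr_eq [LHS]eq_sym addrC.
exists (fun v : 'rV_(1 + n) => (lsubmx v 0 0, rsubmx v)) => [[x w] _ | v _] /=.
  by rewrite row_mxKl row_mxKr mxE eqxx mulr1n.
by rewrite -mx11_scalar hsubmxK.
Qed.

(** The substitution is inverse to [u = x + i * y], [v = x - i * y], which factors
    [x ^+ 2 + y ^+ 2]. *)
Lemma hyperbolic_coordinates (F : fieldType) (i u v : F) :
  (2%:R : F) != 0 -> i ^+ 2 = -1 ->
  ((u + v) / 2%:R) ^+ 2 + ((u - v) / (2%:R * i)) ^+ 2 = u * v.
Proof.
move=> two_neq0 ii; rewrite !expr_div_n exprMn ii.
have four_neq0 : (4%:R : F) != 0 by rewrite (natrM _ 2 2) mulf_neq0.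
by field; rewrite four_neq0 ?oppr_eq0 four_neq0.
Qed.

Lemma sqrtN1_neq0 (F : fieldType) (i : F) : i ^+ 2 = -1 -> i != 0.
Proof. by move=> ii; rewrite -sqrf_eq0 ii oppr_eq0 oner_eq0. Qed.

Lemma nonsquare_neq0 (R : nzRingType) (d : R) : (forall x, x ^+ 2 != d) -> d != 0.
Proof. by move=> /(_ 0); rewrite expr0n eq_sym. Qed.

(** In hyperbolic coordinates the count is a sum of [level S (a - u * v)]. The terms with [u = 0]
    give [#|F| * level S a]; for each [u != 0] the argument runs once through [F], which gives
    [#|F| ^ n]. *)
Lemma level_hyperbolic (F : finFieldType) (n : nat) (S : 'M[F]_n) (a i : F) :
  (2%:R : F) != 0 -> i ^+ 2 = -1 ->
  level (block_mx (1%:M : 'M_1) 0 0 (block_mx (1%:M : 'M_1) 0 0 S)) a =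
    (#|F| * level S a + #|F|.-1 * #|F| ^ n)%N.
Proof.
move=> two_neq0 ii; have i_neq0 := sqrtN1_neq0 ii.
rewrite level_block (eq_bigr _ (fun x _ => level_block _ _)) pair_bigA /=.
rewrite (reindex (fun p : F * F => ((p.1 + p.2) / 2%:R, (p.1 - p.2) / (2%:R * i)))) /=; last first.
  exists (fun p => (p.1 + i * p.2, p.1 - i * p.2)) => -[x y] _ /=; congr (_, _);
    by field; rewrite ?i_neq0 ?two_neq0.
transitivity (\sum_u \sum_v level S (a - u * v)%R)%N.
  rewrite pair_bigA; apply: eq_bigr => -[u v] _ /=; congr level.
  by rewrite -(hyperbolic_coordinates u v two_neq0 ii) opprD addrA.
rewrite (bigD1 0) //=; congr addn.
  by rewrite (eq_bigr (fun=> level S a)) ?sum_nat_const // => v _; rewrite mul0r subr0.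
rewrite (eq_bigr (fun=> #|F| ^ n)%N) => [|u u_neq0].
  by rewrite sum_nat_const cardC1.
rewrite -(sum_level S) [RHS](reindex (fun v => a - u * v)) //.
exists (fun b => (a - b) / u) => v _; by field.
Qed.

Lemma exists_nonsquare (F : finFieldType) : (2%:R : F) != 0 -> exists d : F, forall x, x ^+ 2 != d.
Proof.
move=> two_neq0; apply/not_existsP => squares.
have sq (d : F) : exists x : F, x ^+ 2 == d.
  by have /existsNP[x /negP] := squares d; rewrite negbK => /eqP <-; exists x.
pose g d := xchoose (sq d); have gK : cancel g (fun x => x ^+ 2).
  by move=> d; apply/eqP/(xchooseP (sq d)).
have [h gh hg] := injF_bij (can_inj gK).
have sq_inj : injective (fun x : F => x ^+ 2).
  by move=> x y /= xy; rewrite -(hg x) -(hg y); congr g; rewrite -[LHS]gK -[RHS]gK !hg.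
have /eqP := sq_inj 1 (-1) (esym (sqrrN 1)).
by rewrite -subr_eq0 opprK -mulr2n (negPf two_neq0).
Qed.

(** The left side is at most 2 for every [b], and its sum over all [b] is [2 * #|F|]; so equality
    holds throughout. *)
Lemma card_square_roots (F : finFieldType) (d b : F) :
  (forall x, x ^+ 2 != d) ->
  (#|[set x : F | (x ^+ 2 == b)%R]| + #|[set x : F | (d * x ^+ 2 == b)%R]| = 2)%N.
Proof.
move=> d_nonsq; have d_neq0 := nonsquare_neq0 d_nonsq.
pose f c := (#|[set x : F | (x ^+ 2 == c)%R]| + #|[set x : F | (d * x ^+ 2 == c)%R]|)%N.
have root_le c e : e != 0 -> (#|[set x : F | (e * x ^+ 2 == c)%R]| <= 2)%N.
  move=> e_neq0; have [->|[y]] := set_0Vmem [set x : F | e * x ^+ 2 == c]; first by rewrite cards0.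
  rewrite inE => /eqP <-; apply: (@leq_trans #|[set y; (- y)%R]|).
    apply/subset_leq_card/fintype.subsetP => x.
    by rewrite !inE (inj_eq (mulfI e_neq0)) eqf_sqr.
  by rewrite cards2; case: (_ != _).
have f_le c : (f c <= 2)%N.
  have [->|c_neq0] := eqVneq c 0.
    have zero e : e != 0 -> [set x : F | e * x ^+ 2 == 0] = [set 0].
      by move=> e_neq0; apply/setP => x; rewrite !inE mulf_eq0 (negPf e_neq0) sqrf_eq0.
    have := zero 1 (oner_neq0 _); under eq_finset do rewrite mul1r.
    by rewrite /f => ->; rewrite zero // !cards1.
  have := root_le c 1 (oner_neq0 _); under eq_finset do rewrite mul1r.
  have [none _|[y]] := set_0Vmem [set x : F | x ^+ 2 == c].
    by rewrite /f none cards0; apply: root_le.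
  (* If [c = y ^+ 2 = d * x ^+ 2] is nonzero, then [d] is the square of [y / x]. *)
  rewrite inE => /eqP yc le2; rewrite /f [X in (_ + X)%N](_ : _ = 0)%N ?addn0 //.
  apply/eqP; rewrite cards_eq0; apply/eqP/setP => x; rewrite !inE; apply/negbTE.
  apply: contraNneq (d_nonsq (y / x)) => dxc; apply/eqP.
  have x_neq0 : x != 0.
    by apply: contraNneq c_neq0 => x0; rewrite -dxc x0 expr0n mulr0.
  by rewrite expr_div_n yc -dxc mulfK // expf_neq0.
have fibers (h : F -> F) : (\sum_c #|[set x | h x == c]| = #|F|)%N.
  rewrite -sum1_card [RHS](partition_big h xpredT) //; apply: eq_bigr => c _.
  by rewrite -sum1_card; apply: eq_bigl => x; rewrite inE.
have f_sum : (\sum_c f c = \sum_(c : F) 2)%N.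
  rewrite big_split /= (fibers (fun x => (x ^+ 2)%R)) (fibers (fun x => (d * x ^+ 2)%R)).
  by rewrite sum_nat_const muln2 addnn.
have := leqif_sum (fun c (_ : xpredT c) => conj (f_le c) (erefl (f c == 2%N))).
by rewrite f_sum => -[_]; rewrite eqxx => /esym/forall_inP/(_ b isT)/eqP.
Qed.

Fixpoint disc_form (F : fieldType) (d : F) (n : nat) : 'M[F]_n.+1 :=
  match n with
  | 0 => d%:M
  | n'.+1 => block_mx (1%:M : 'M_1) 0 0 (disc_form d n')
  end.

Lemma disc_form_sym (F : fieldType) (d : F) (n : nat) : (disc_form d n)^T = disc_form d n.
Proof.
elim: n => [|n IHn] /=; first by rewrite tr_scalar_mx.
by rewrite (@tr_block_mx _ 1 n.+1 1 n.+1) trmx1 !trmx0 IHn.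
Qed.

Lemma det_disc_form (F : fieldType) (d : F) (n : nat) : \det (disc_form d n) = d.
Proof. by elim: n => [|n IHn] /=; rewrite ?det_scalar1 // (@det_ublock _ 1 n.+1) det1 mul1r. Qed.

Lemma disc_form_unit (F : fieldType) (d : F) (n : nat) : d != 0 -> disc_form d n \in unitmx.
Proof. by rewrite unitmxE det_disc_form unitfE. Qed.

Lemma disc_form1 (F : fieldType) (n : nat) : disc_form 1 n = 1%:M :> 'M[F]_n.+1.
Proof. by elim: n => [|n IHn] //=; rewrite IHn -scalar_mx_block. Qed.

Lemma level_scalar (F : finFieldType) (d a : F) :
  level (d%:M : 'M_1) a = #|[set x : F | (d * x ^+ 2 == a)%R]|.
Proof.
rewrite /level -!sum1_card (reindex (fun x : F => x%:M : 'M_1)) /=.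
  apply: eq_bigl => x; rewrite !inE tr_scalar_mx -!scalar_mxM mulrAC -expr2 mulrC.
  by apply/eqP/eqP => [/matrixP/(_ 0 0)|->//]; rewrite !mxE eqxx !mulr1n.
exists (fun v : 'M_1 => v 0 0) => [x _ | v _] /=; first by rewrite mxE eqxx mulr1n.
by rewrite -mx11_scalar.
Qed.

(** In dimension 1 this is [card_square_roots]; each further coordinate sums the identity over
    [#|F|] shifted values. *)
Lemma level_disc_form_add (F : finFieldType) (d a : F) (n : nat) :
  (forall x, x ^+ 2 != d) ->
  (level (disc_form 1 n) a + level (disc_form d n) a = 2 * #|F| ^ n)%N.
Proof.
move=> d_nonsq; elim: n a => [|n IHn] a /=.
  rewrite !level_scalar expn0 muln1 -[RHS](card_square_roots a d_nonsq); congr (_ + _)%N.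
  by apply: eq_card => x; rewrite !inE mul1r.
rewrite !level_block -big_split /= (eq_bigr _ (fun x _ => IHn _)) sum_nat_const.
by rewrite expnS mulnCA.
Qed.

(** * Classification of forms over a finite field *)

Lemma square_class (F : finFieldType) (d c : F) :
  (forall x, x ^+ 2 != d) -> c != 0 ->
  exists2 s : F, s != 0 & c = s ^+ 2 \/ c = d * s ^+ 2.
Proof.
move=> d_nonsq c_neq0; have := card_square_roots c d_nonsq.
have [->|[s]] := set_0Vmem [set x : F | (x ^+ 2 == c)%R].
  have [->|[s]] := set_0Vmem [set x : F | (d * x ^+ 2 == c)%R]; first by rewrite !cards0.
  rewrite inE => /eqP sc _; exists s; last by right.
  by apply: contraNneq c_neq0 => s0; rewrite -sc s0 expr0n mulr0.
rewrite inE => /eqP sc _; exists s; last by left.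
by apply: contraNneq c_neq0 => s0; rewrite -sc s0 expr0n.
Qed.

(** This is immediate if [c] or [c'] is a square. Otherwise the form is [d] times a sum of two
    squares, which is hyperbolic and takes the value [d^-1]. *)
Lemma binary_form_represents1 (F : finFieldType) (i c c' : F) :
  (2%:R : F) != 0 -> i ^+ 2 = -1 -> c != 0 -> c' != 0 ->
  exists x y : F, x ^+ 2 * c + y ^+ 2 * c' = 1.
Proof.
move=> two_neq0 ii c_neq0 c'_neq0; have [d d_nonsq] := exists_nonsquare two_neq0.
have d_neq0 := nonsquare_neq0 d_nonsq.
have [s s_neq0 sc] := square_class d_nonsq c_neq0.
have [t t_neq0 tc] := square_class d_nonsq c'_neq0.
case: sc => ->; first by exists s^-1, 0; rewrite expr0n mul0r addr0 -exprMn mulVf ?expr1n.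
case: tc => ->; first by exists 0, t^-1; rewrite expr0n mul0r add0r -exprMn mulVf ?expr1n.
have i_neq0 := sqrtN1_neq0 ii.
(* The point with hyperbolic coordinates [d^-1] and [1], rescaled by [s] and [t]. *)
exists ((d^-1 + 1) / 2%:R / s), ((d^-1 - 1) / (2%:R * i) / t).
rewrite !(expr_div_n _ s) !(expr_div_n _ t) ![_ / _ * (d * _)]mulrA.
rewrite ![_ / (_ ^+ 2) * d * _]mulrAC !divfK ?expf_neq0 // -mulrDl.
by rewrite hyperbolic_coordinates // mulr1 mulVf.
Qed.

Lemma form_represents1 (F : finFieldType) (i : F) (n : nat) (S : 'M[F]_(1 + n.+1)) :
  (2%:R : F) != 0 -> i ^+ 2 = -1 -> S^T = S -> S \in unitmx ->
  exists v : 'rV_(1 + n.+1), v *m S *m v^T = 1%:M.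
Proof.
move=> two_neq0 ii S_sym S_unit.
have unit_neq0 m (T : 'M[F]_m.+1) : T \in unitmx -> T != 0.
  by apply: contraTneq => ->; rewrite unitmxE det0 unitr0.
have [v vSv] := anisotropic_vector two_neq0 S_sym (unit_neq0 _ _ S_unit).
have [A [S' [AS S'_sym S'_unit]]] := form_split S_sym S_unit (mx11_scalar _) vSv.
have [w wSw] := anisotropic_vector two_neq0 S'_sym (unit_neq0 _ _ S'_unit).
have [x [y xy]] := binary_form_represents1 two_neq0 ii vSv wSw.
exists (row_mx x%:M (y *: w) *m A).
rewrite form_mul AS mul_row_block !mulmx0 addr0 add0r tr_row_mx mul_row_col.
rewrite tr_scalar_mx -!scalar_mxM linearZ /= -!(scalemxAl, scalemxAr) scalerA.
rewrite [w *m _ *m _]mx11_scalar.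
by rewrite -mul_scalar_mx -scalar_mxM -raddfD -xy; congr scalar_mx; ring.
Qed.

(** Vectors of value 1 are split off while the dimension is at least 2; the last entry is normalised
    by its square class. *)
Lemma disc_form_classification (F : finFieldType) (i d : F) (n : nat) (S : 'M[F]_n.+1) :
  (2%:R : F) != 0 -> i ^+ 2 = -1 -> (forall x, x ^+ 2 != d) -> S^T = S -> S \in unitmx ->
  exists2 e, e = 1 \/ e = d & exists A : 'M_n.+1, A *m S *m A^T = disc_form e n.
Proof.
move=> two_neq0 ii d_nonsq; elim: n S => [|n IHn] S S_sym S_unit.
  have c_neq0 : S 0 0 != 0.
    by move: S_unit; rewrite unitmxE [S]mx11_scalar det_scalar1 unitfE mxE eqxx.
  have [s s_neq0 [sc|sc]] := square_class d_nonsq c_neq0.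
    exists 1; [by left | exists s^-1%:M].
    by rewrite [S]mx11_scalar tr_scalar_mx -!scalar_mxM sc mulrAC -expr2 -exprMn mulVf ?expr1n.
  exists d; [by right | exists s^-1%:M].
  rewrite [S]mx11_scalar tr_scalar_mx -!scalar_mxM sc mulrAC -expr2 mulrCA -exprMn mulVf //.
  by rewrite expr1n mulr1.
have [v vSv] := form_represents1 two_neq0 ii S_sym S_unit.
have [A [S' [AS S'_sym S'_unit]]] := form_split S_sym S_unit vSv (oner_neq0 _).
have [e e1d [B BS']] := IHn S' S'_sym S'_unit.
exists e => //; exists (block_mx 1%:M 0 0 B *m A).
by rewrite (form_block_mul _ _ AS) BS' !mulr1.
Qed.

Definition projections_of_form (F : finFieldType) (k n : nat) (D : 'M[F]_k) : {set 'M[F]_n} :=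
  [set X^T *m invmx D *m X | X in frames D (1%:M : 'M_n)].

(** Two frames give the same projection exactly when they differ by an element of the isometry group
    [frames D D], so all fibres have its size. *)
Lemma card_projections_of_form (F : finFieldType) (k n : nat) (D : 'M[F]_k) :
  D \in unitmx ->
  #|frames D (1%:M : 'M_n)| = (#|projections_of_form n D| * #|frames D D|)%N.
Proof.
move=> D_unit; rewrite -[LHS]sum1_card (partition_big_imset (fun X => X^T *m invmx D *m X)) /=.
rewrite -sum_nat_const; apply: eq_bigr => Q /imsetP[X]; rewrite inE mulmx1 => /eqP XX {Q}->.
have [_ _ XQ] := sym_idempotent_orthogonal_projection D_unit XX.
have X_free (m : nat) : injective (fun A : 'M_(m, k) => A *m X).
  move=> A B /(congr1 (mulmx^~ (X^T *m invmx D))) /=.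
  by rewrite -!mulmxA !(mulmxA X) XX mulmxV // !mulmx1.
rewrite sum1_card -(card_imset (mem (frames D D)) (X_free k)).
apply: eq_card => Y; rewrite unfold_in /=; apply/idP/imsetP => [|[A A_in ->]].
  rewrite inE mulmx1 => /andP[/eqP YY /eqP QE].
  have [_ _ YQ] := sym_idempotent_orthogonal_projection D_unit YY.
  have YE : Y = Y *m X^T *m invmx D *m X by rewrite -[LHS]YQ QE !mulmxA.
  exists (Y *m X^T *m invmx D) => //; move: (Y *m X^T *m invmx D) YE => B YE.
  by rewrite inE -{1}XX mulmxA -[_ *m X^T *m _]mulmxA -trmx_mul -YE YY.
have {A_in} ADA : A *m D *m A^T = D by move: A_in; rewrite inE => /eqP.
have A_unit := form_unitmx D_unit ADA.
have AXX : A *m X *m (A *m X)^T = D.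
  by rewrite trmx_mul !mulmxA -(mulmxA A) XX.
have AX_sub : (X^T *m invmx D *m X <= A *m X)%MS.
  apply: submx_trans (submxMl _ _) _.
  by rewrite -[Z in (Z <= _)%MS](mulKmx A_unit) submxMl.
have [/andP[/eqP Q_sym _] _ _] := sym_idempotent_orthogonal_projection D_unit XX.
rewrite inE mulmx1 AXX eqxx /=; apply/eqP.
by apply: orthogonal_projection_unique => //; rewrite -(mulmxA A) XQ.
Qed.

Lemma card_sym_idempotents (F : finFieldType) (i d : F) (k n : nat) :
  (2%:R : F) != 0 -> i ^+ 2 = -1 -> (forall x, x ^+ 2 != d) ->
  #|[set Q : 'M[F]_n | sym_idempotent Q & \rank Q == k.+1]| =
  (#|projections_of_form n (disc_form (1 : F) k)| + #|projections_of_form n (disc_form d k)|)%N.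
Proof.
move=> two_neq0 ii d_nonsq.
have d_neq0 := nonsquare_neq0 d_nonsq.
have in_proj e (X : 'M_(k.+1, n)) : X \in frames (disc_form e k) 1%:M -> X *m X^T = disc_form e k.
  by rewrite inE mulmx1 => /eqP.
have [unit1 unit_d] := (disc_form_unit k (oner_neq0 F), disc_form_unit k d_neq0).
(* The two types are disjoint: frames of a common projection differ by a matrix [A], and
   determinants would give [d = \det A ^+ 2]. *)
rewrite -cardsUI [_ :&: _](_ : _ = finset.set0) ?cards0 ?addn0; last first.
  apply/finset.setP => Q; rewrite !inE.
  apply/andP => -[/imsetP[X /in_proj XX ->] /imsetP[Y /in_proj YY QE]].
  have [_ _ YQ] := sym_idempotent_orthogonal_projection unit_d YY.
  have YE : Y = Y *m X^T *m invmx (disc_form 1 k) *m X by rewrite -[LHS]YQ -QE !mulmxA.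
  have := congr1 determinant YY; rewrite YE; move: (Y *m X^T *m _) => A.
  rewrite trmx_mul mulmxA -(mulmxA A) XX !det_mulmx det_tr !det_disc_form mulr1.
  by apply/eqP; rewrite -expr2.
apply: eq_card => Q; rewrite !inE; apply/andP/orP => [[Q_idem /eqP rkQ]|].
  have [V freeV eqVQ] := sym_idempotent_basis rkQ.
  have [VQ VV_unit] := sym_idempotent_gram_unit Q_idem freeV eqVQ.
  have VV_sym : (V *m V^T)^T = V *m V^T by rewrite trmx_mul trmxK.
  have [e e1d [A AVVA]] := disc_form_classification two_neq0 ii d_nonsq VV_sym VV_unit.
  have unit_e : disc_form e k \in unitmx by case: e1d => ->.
  have A_unit := form_unitmx unit_e AVVA.
  have AVAV : A *m V *m (A *m V)^T = disc_form e k by rewrite trmx_mul !mulmxA -(mulmxA A).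
  have Q_sym : Q^T = Q by case/andP: Q_idem => /eqP.
  suff : Q \in projections_of_form n (disc_form e k) by case: e1d => ->; [left | right].
  apply/imsetP; exists (A *m V); first by rewrite inE mulmx1 AVAV.
  apply/esym/orthogonal_projection_unique => //; first by rewrite -mulmxA VQ.
  by rewrite -eqVQ -[X in (X <= _)%MS](mulKmx A_unit) submxMl.
by case=> /imsetP[X /in_proj XX ->];
  [have [] := sym_idempotent_orthogonal_projection unit1 XX
  | have [] := sym_idempotent_orthogonal_projection unit_d XX]; move=> -> -> _.
Qed.

(** * Counting nondegenerate subspaces *)

(** [q] times the number of vectors of value 1 in an [n]-dimensional space; [s = 1] for square
    discriminant and [s = -1] otherwise. *)
Definition level_form (q s : int) (n : nat) : int :=
  if odd n then q * (q ^+ n./2 * (q ^+ n./2 + s)) else q ^+ n./2 * (q ^+ n./2 - s).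

(** A closed form, with denominators cleared, for the number [a] of nondegenerate [k]-spaces of the
    type with sign [s] and codimension [m]. *)
Definition projection_form (q s a : int) (k m : nat) : Prop :=
  let j := k./2 in let l := m./2 in
  let d := sq_factorial q j * sq_factorial q l in
  let c := (q ^+ (j * l)) ^+ 2 * sq_factorial q (j + l) in
  match odd k, odd m with
  | false, false =>
      2%:R * (q ^+ (j + l) + 1) * (d * a) = c * ((q ^+ j + s) * (q ^+ l + s))
  | false, true => 2%:R * (d * a) = c * (q ^+ j * (q ^+ j + s))
  | true, false => 2%:R * (d * a) = c * (q ^+ l * (q ^+ l + s))
  | true, true => 2%:R * (d * a) = c * (q ^+ (j + l) * (q ^+ (j + l).+1 - 1))
  end.

Lemma projection_form_base (q s a : int) (m : nat) :
  q != 0 -> s = 1 \/ s = -1 ->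
  2%:R * q * a = level_form q (if odd m then 1 else s) m.+1 -> projection_form q s a 1 m.
Proof.
move=> q_neq0 s1; rewrite /level_form /projection_form -(odd_double_half m).
move: (m./2) => l; case: (odd m);
  rewrite ?add1n ?add0n !half_doubleE /= !sq_factorial0 ?add0n mul1r ?mul0n => H;
  apply: (mulfI q_neq0).
  rewrite exprS in H *.
  transitivity (sq_factorial q l * (2%:R * q * a)); [ring | rewrite H; ring].
transitivity (sq_factorial q l * (2%:R * q * a)); [ring | rewrite H; ring].
Qed.

Lemma level_form_neq0 (q s : int) (n : nat) :
  (1 < q) -> s = 1 \/ s = -1 -> (1 < n)%N -> level_form q s n != 0.
Proof.
move=> q_gt1 s1 n_gt1; rewrite /level_form.
have q_gt0 : 0 < q by apply: Order.POrderTheory.lt_trans q_gt1.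
have qn : 1 < q ^+ n./2 by rewrite Num.Theory.exprn_egt1 //; lia.
have q1 : q ^+ n./2 + 1 != 0 by lia.
have q2 : q ^+ n./2 - 1 != 0 by lia.
have qn0 : q ^+ n./2 != 0 by lia.
have q0 : q != 0 by lia.
by case: s1 => ->; rewrite ?opprK; case: (odd n); rewrite !mulf_neq0.
Qed.

(** The assumed recurrence is what adding a unit vector does to the frames of the ambient space and
    of the subspace itself: each count is multiplied by the size of a sphere. *)
Lemma projection_form_step (q s a a' : int) (k m : nat) :
  (1 < q) -> s = 1 \/ s = -1 -> (0 < k)%N ->
  a' * level_form q s k.+1 = level_form q 1 (k.+1 + m) * a ->
  projection_form q s a k m -> projection_form q s a' k.+1 m.
Proof.
move=> q_gt1 s1 k_gt0; have E_neq0 := @level_form_neq0 q s k.+1 q_gt1 s1 k_gt0.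
have q_neq0 : q != 0 by lia.
have uv1_neq0 : q ^+ (k./2 + m./2).+1 + 1 != 0.
  by have := Num.Theory.exprn_ge0 (k./2 + m./2).+1 (_ : 0 <= q); lia.
have -> : level_form q 1 (k.+1 + m) = if odd k (+) odd m
    then q ^+ (k./2 + m./2).+1 * (q ^+ (k./2 + m./2).+1 - 1)
    else let h := q ^+ (k./2 + m./2 + odd k) in q * (h * (h + 1)).
  have km : odd (k.+1 + m) = ~~ (odd k (+) odd m) by rewrite addSn /= oddD.
  rewrite /level_form km; case E : (odd k (+) odd m).
    by have -> : (k.+1 + m)./2 = (k./2 + m./2).+1 by lia.
  by have -> : (k.+1 + m)./2 = (k./2 + m./2 + odd k)%N by lia.
move: E_neq0 uv1_neq0; rewrite /level_form /projection_form.
rewrite -(odd_double_half k) -(odd_double_half m) {k_gt0}.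
move: (k./2) (m./2) => j l.
case: (odd k); case: (odd m); rewrite ?add1n ?add0n !half_doubleE; rewrite /= ?addn1 ?addn0
  ?addSn ?sq_factorialS ?mulSn ?(exprS q) ?exprD;
  move: (q ^+ j) (q ^+ l) (q ^+ (j * l)) (sq_factorial q j) (sq_factorial q l)
    (sq_factorial q (j + l)) => u v w Pj Pl P E_neq0 uv1_neq0 rec H.
- apply: (mulfI E_neq0).
  transitivity (((q * u) ^+ 2 - 1) * 2%:R * Pj * Pl * (a' * (q * u * (q * u - s)))); first by ring.
  rewrite rec.
  transitivity (((q * u) ^+ 2 - 1) * (q * (q * (u * v) * (q * (u * v) + 1))) *
    (2%:R * (Pj * Pl * a))).
    by ring.
  by rewrite H; case: s1 => ->; ring.
- apply: (mulfI E_neq0).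
  transitivity (((q * u) ^+ 2 - 1) * 2%:R * (q * (u * v) + 1) * Pj * Pl *
    (a' * (q * u * (q * u - s)))); first by ring.
  rewrite rec; transitivity (((q * u) ^+ 2 - 1) * (q * (u * v) + 1) *
    (q * (u * v) * (q * (u * v) - 1)) * (2%:R * (Pj * Pl * a))).
    by ring.
  by rewrite H; case: s1 => ->; ring.
- apply: (mulfI E_neq0).
  transitivity (2%:R * Pj * Pl * (a' * (q * (u * (u + s))))); first by ring.
  rewrite rec; transitivity (q * (u * v) * (q * (u * v) - 1) * (2%:R * (Pj * Pl * a))).
    by ring.
  by rewrite H; ring.
- apply: (mulfI E_neq0).
  transitivity (2%:R * Pj * Pl * (a' * (q * (u * (u + s))))); first by ring.
  rewrite rec; transitivity (q * (u * v) * (2%:R * (u * v + 1) * (Pj * Pl * a))); first by ring.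
  by rewrite H; ring.
Qed.

(** For even [k] and [m] this rests on [(u + 1) * (v + 1) + (u - 1) * (v - 1) = 2 * (u * v + 1)]
    with [u = q ^+ j], [v = q ^+ l]; in the other cases the terms with [s] cancel or are absent. *)
Lemma projection_form_add (q a b : int) (k m : nat) :
  (1 < q) -> projection_form q 1 a k m -> projection_form q (-1) b k m ->
  sq_factorial q k./2 * sq_factorial q m./2 * (a + b) = gr_count q k m.
Proof.
move=> q_gt1; have uv1_neq0 : q ^+ (k./2 + m./2) + 1 != 0.
  by have := Num.Theory.exprn_ge0 (k./2 + m./2) (_ : 0 <= q); lia.
have two_neq0 : (2%:R : int) != 0 by [].
have dbl n : q ^+ n.*2 = q ^+ n * q ^+ n by rewrite -addnn exprD.
rewrite /projection_form /gr_count !dbl.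
move: (k./2) (m./2) uv1_neq0 => j l uv1_neq0.
case: (odd k); case: (odd m) => Ha Hb; apply: (mulfI two_neq0).
1-3: transitivity (2%:R * (sq_factorial q j * sq_factorial q l * a) +
    2%:R * (sq_factorial q j * sq_factorial q l * b)); [by ring | by rewrite Ha Hb; ring].
apply: (mulfI uv1_neq0).
transitivity (2%:R * (q ^+ (j + l) + 1) * (sq_factorial q j * sq_factorial q l * a) +
   2%:R * (q ^+ (j + l) + 1) * (sq_factorial q j * sq_factorial q l * b)); first by ring.
by rewrite Ha Hb exprD; ring.
Qed.

Definition class_sign (F : finFieldType) (d a : F) (s : int) : Prop :=
  (a = 1 /\ s = 1) \/ (a = d /\ s = -1).

Lemma card_finField_gt1 (F : finFieldType) : 1 < (#|F|)%:Z.
Proof. exact: finNzRing_gt1. Qed.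

(** Induction in steps of 2, splitting off a hyperbolic plane. The classes are separated in odd
    dimension only, starting from dimension 1, where [x ^+ 2 = a] has two roots or none. *)
Lemma level_id (F : finFieldType) (i d a : F) (s : int) (n : nat) :
  (2%:R : F) != 0 -> i ^+ 2 = -1 -> (forall x, x ^+ 2 != d) -> class_sign d a s ->
  #|F|%:Z * (level (1%:M : 'M[F]_n) a)%:Z = level_form #|F|%:Z (if odd n then s else 1) n.
Proof.
move=> two_neq0 ii d_nonsq as_class; have q_gt0 : (0 < #|F|)%N by apply/card_gt0P; exists 0.
have d_neq0 := nonsquare_neq0 d_nonsq.
have a_neq0 : a != 0 by case: as_class => -[-> _] //; apply: oner_neq0.
have [m] := ubnP n; elim: m n => // m IHm [|[|n]] lt_n.
- suff lev0 : level (1%:M : 'M[F]_0) a = 0%N by rewrite lev0 mulr0 /level_form /= expr0 subrr mulr0.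
  apply/eqP; rewrite cards_eq0; apply/eqP/finset.setP => v; rewrite !inE.
  apply/negbTE; apply: contraNneq a_neq0 => /matrixP/(_ 0 0).
  by rewrite !mxE big_ord0 eqxx mulr1n => <-.
- rewrite level_scalar /level_form /= expr0 mul1r; congr (_ * _).
  case: as_class => -[-> ->].
    rewrite (_ : [set x : F | _] = [set 1; -1]%SET); last first.
      by apply/finset.setP => x; rewrite !inE mul1r sqrf_eq1.
    by rewrite cards2 -subr_eq0 opprK -mulr2n two_neq0.
  rewrite (_ : [set x : F | _] = finset.set0) ?cards0 //.
  by apply/finset.setP => x; rewrite !inE mul1r (negPf (d_nonsq x)).
have -> : 1%:M = block_mx (1%:M : 'M_1) 0 0 (block_mx (1%:M : 'M_1) 0 0 (1%:M : 'M[F]_n)).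
  by rewrite -[block_mx _ _ _ 1%:M]scalar_mx_block -scalar_mx_block.
rewrite (level_hyperbolic _ _ two_neq0 ii) PoszD !PoszM mulrDr IHm; last by lia.
rewrite (predn_int q_gt0) -[(#|F| ^ n)%N%:Z]natz natrX natz.
move: (Posz #|F|) => q; rewrite /level_form -(odd_double_half n).
move: (n./2) => h; case: (odd n); rewrite ?add1n ?add0n !half_doubleE -?muln2 ?(exprS q) exprM.
  by ring.
by ring.
Qed.

Lemma level_disc_form (F : finFieldType) (i d a : F) (s : int) (n : nat) :
  (2%:R : F) != 0 -> i ^+ 2 = -1 -> (forall x, x ^+ 2 != d) -> class_sign d a s ->
  #|F|%:Z * (level (disc_form a n) 1)%:Z = level_form #|F|%:Z s n.+1.
Proof.
move=> two_neq0 ii d_nonsq as_class.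
have id_class : class_sign d 1 1 by left.
have id_level := level_id n.+1 two_neq0 ii d_nonsq id_class.
case: as_class => -[-> ->]; first by rewrite disc_form1 id_level; case: odd.
have := congr1 Posz (level_disc_form_add 1 n d_nonsq).
rewrite disc_form1 PoszD PoszM -[(#|F| ^ n)%N%:Z]natz natrX natz => /(canRL (addKr _)) ->.
rewrite mulrDr mulrN id_level; move: (Posz #|F|) => q.
rewrite /level_form -(odd_double_half n).
move: (n./2) => h; case: (odd n); rewrite ?add1n ?add0n !half_doubleE -?muln2 ?(exprS q) ?exprM.
  by ring.
by ring.
Qed.

Lemma projection_form_card (F : finFieldType) (i d a : F) (s : int) (k m : nat) :
  (2%:R : F) != 0 -> i ^+ 2 = -1 -> (forall x, x ^+ 2 != d) -> class_sign d a s ->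
  projection_form #|F|%:Z s (#|projections_of_form (k.+1 + m) (disc_form a k)|%:Z) k.+1 m.
Proof.
move=> two_neq0 ii d_nonsq as_class.
have q_gt1 := card_finField_gt1 F; have q_neq0 : #|F|%:Z != 0 by lia.
have d_neq0 := nonsquare_neq0 d_nonsq.
have a_neq0 : a != 0 by case: as_class => -[-> _] //; apply: oner_neq0.
have s1 : s = 1 \/ s = -1 by case: as_class => -[_ ->]; [left | right].
have card_proj e n := card_projections_of_form n (disc_form_unit e a_neq0).
elim: k => [|k IHk].
  apply: projection_form_base => //.
  have -> : (if odd m then 1 else s) = (if odd m.+1 then s else 1) by rewrite /=; case: odd.
  rewrite -(level_id m.+1 two_neq0 ii d_nonsq as_class).
  rewrite [level _ _]card_proj /= PoszM.
  (* The isometries of a line are [1] and [-1]. *)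
  have -> : #|frames (a%:M : 'M_1) (a%:M : 'M_1)| = 2%N; last by ring.
  rewrite -[LHS]/(level (a%:M : 'M_1) a) level_scalar.
  transitivity #|[set 1; (-1)%R : F]|; last first.
    by rewrite cards2 -subr_eq0 opprK -mulr2n two_neq0.
  apply: eq_card => x; rewrite !inE -{2}[a]mulr1 (inj_eq (mulfI a_neq0)).
  by rewrite sqrf_eq1.
apply: (projection_form_step q_gt1 s1 (ltn0Sn k)) IHk.
(* [card_frames_block] is applied in the ambient space and to the form itself; the quotient of the
   two counts is the recurrence of [projection_form_step]. *)
have := card_frames_block (disc_form a k) two_neq0 (trmx1 F (k.+1 + m)) (unitmx1 F (k.+1 + m)).
have := card_frames_block (disc_form a k) two_neq0 (disc_form_sym a k) (disc_form_unit k a_neq0).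
rewrite /= -scalar_mx_block => frames_self frames_id.
have := card_proj k.+1 (k.+2 + m)%N; rewrite [LHS]frames_id [X in _ = (_ * X)%N]frames_self.
rewrite card_proj {frames_self frames_id}.
set b := #|frames (disc_form a k) (disc_form a k)|.
have b_neq0 : b%:Z != 0.
  suff: (0 < b)%N by lia.
  by apply/card_gt0P; exists 1%:M; rewrite inE mul1mx trmx1 mulmx1.
move=> /(congr1 (fun x => Posz x)) /=; rewrite !PoszM => E.
apply: (mulfI (mulf_neq0 b_neq0 q_neq0)).
rewrite -[level_form _ s _](level_disc_form k.+1 two_neq0 ii d_nonsq as_class).
have id_class : class_sign d 1 1 by left.
have := level_id (k.+2 + m) two_neq0 ii d_nonsq id_class; rewrite if_same => <-.
move: E; rewrite -/(disc_form a k.+1) -!/(level _ _).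
move: (Posz #|F|) (Posz b) (Posz #|projections_of_form _ _|) (Posz #|projections_of_form _ _|).
move: (Posz (level _ _)) (Posz (level _ _)) => x y z c u v E.
transitivity (z * z * (u * (x * c))); first by ring.
by rewrite -E; ring.
Qed.

Lemma card_sym_idempotents_form (F : finFieldType) (i : F) (k m : nat) :
  (2%:R : F) != 0 -> i ^+ 2 = -1 -> (0 < k)%N ->
  let q := #|F|%:Z in
  sq_factorial q k./2 * sq_factorial q m./2 *
    (#|[set Q : 'M[F]_(k + m) | sym_idempotent Q & \rank Q == k]|%:Z) = gr_count q k m.
Proof.
case: k => // k two_neq0 ii _ q; have [d d_nonsq] := exists_nonsquare two_neq0.
rewrite (card_sym_idempotents _ _ two_neq0 ii d_nonsq) PoszD.
apply: projection_form_add; first exact: card_finField_gt1.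
- by apply: (projection_form_card _ _ two_neq0 ii d_nonsq); left.
- by apply: (projection_form_card _ _ two_neq0 ii d_nonsq); right.
Qed.

(** * Cosets over an algebraically closed field *)

Local Open Scope classical_set_scope.

Section FrobeniusMorphism.
Variables (K : fieldType) (q : nat).

(** The hypothesis on [q] is an argument so that the map can carry a ring morphism instance. *)
Definition frob of [pchar K].-nat q := fun x : K => x ^+ q.

Variable char_q : [pchar K].-nat q.

Lemma frob_is_zmod_morphism : zmod_morphism (frob char_q).
Proof. by move=> x y; rewrite /frob exprDn_pchar ?exprNn_pchar. Qed.

Lemma frob_is_monoid_morphism : monoid_morphism (frob char_q).
Proof. by split=> [|x y]; rewrite /frob ?expr1n ?exprMn. Qed.

HB.instance Definition _ := GRing.isZmodMorphism.Build K K (frob char_q) frob_is_zmod_morphism.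
HB.instance Definition _ := GRing.isMonoidMorphism.Build K K (frob char_q) frob_is_monoid_morphism.

End FrobeniusMorphism.

Section Cosets.
Variables (K : closedFieldType) (k m : nat).

Definition coord_proj : 'M[K]_(k + m) := block_mx 1%:M 0 0 0.

(** A nondegenerate [k]-space is encoded by the orthogonal projection [Q] onto it,
    and the corresponding coset consists of the rotations taking the span of the
    first [k] basis vectors to it. *)
Definition proj_coset (Q : 'M[K]_(k + m)) : set 'M[K]_(k + m) :=
  [set h | SO K (k + m) h /\ h *m coord_proj *m h^T = Q].

Lemma SO_mulmx_tr (g : 'M[K]_(k + m)) : SO K (k + m) g -> g *m g^T = 1%:M.
Proof. by case=> /mulmx1C. Qed.

Lemma coord_proj_diag : coord_proj = diag_mx (\row_j (j < k)%:R).
Proof.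
by rewrite /coord_proj -pid_mx_block; apply/matrixP => i j; rewrite !mxE -mulnb natrM mulr_natl.
Qed.

(** Block diagonal means commuting with [coord_proj]; for orthogonal [u] this is invariance under
    conjugation. *)
Lemma Levi_SO (u : 'M[K]_(k + m)) :
  SO K (k + m) u -> (Levi K (k + m) k u <-> u *m coord_proj *m u^T = coord_proj).
Proof.
move=> SOu; have uu := SO_mulmx_tr SOu; case: SOu => tuu det_u.
have -> : (u *m coord_proj *m u^T = coord_proj) = (u *m coord_proj = coord_proj *m u).
  apply/propext; split=> [E|->]; last by rewrite -mulmxA uu mulmx1.
  by rewrite -{2}E -mulmxA tuu mulmx1.
rewrite coord_proj_diag mul_mx_diag mul_diag_mx; split=> [[_ u0]|/matrixP uE].
  apply/matrixP => i j; rewrite !mxE mulrC.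
  by have [->//|/u0->] := eqVneq (i < k)%N (j < k)%N; rewrite !mulr0.
split=> // i j ij; have := uE i j; rewrite !mxE; move: ij.
by case: (i < k)%N; case: (j < k)%N; rewrite // ?mulr1 ?mulr0 ?mul1r ?mul0r.
Qed.

(** By [Levi_SO] the stabiliser of [coord_proj] is [L :&: K], so its cosets are the fibres of the
    conjugation map on [SO]. *)
Lemma mxlcoset_proj (g : 'M[K]_(k + m)) :
  SO K (k + m) g ->
  mxlcoset g (Levi K (k + m) k `&` SO K (k + m)) = proj_coset (g *m coord_proj *m g^T).
Proof.
move=> SOg; have gg := SO_mulmx_tr SOg; have [tgg det_g] := SOg.
apply/seteqP; split=> [_ [u [Lu SOu] <-]|h [SOh hQ]].
  have [tuu det_u] := SOu; split.
    split; first by rewrite trmx_mul -mulmxA (mulmxA g^T) tgg mul1mx.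
    by rewrite det_mulmx det_g det_u mulr1.
  by rewrite form_mul; have [/(_ Lu) -> _] := Levi_SO SOu.
have [thh det_h] := SOh; exists (g^T *m h); last by rewrite mulmxA gg mul1mx.
have SOu : SO K (k + m) (g^T *m h).
  split; first by rewrite trmx_mul trmxK -mulmxA (mulmxA g) gg mul1mx.
  by rewrite det_mulmx det_tr det_g det_h mulr1.
split=> //; apply: (proj2 (Levi_SO SOu)).
by rewrite form_mul hQ trmxK !mulmxA tgg mul1mx -mulmxA tgg mulmx1.
Qed.

Lemma proj_coset_nonempty (Q : 'M[K]_(k + m)) :
  (2%:R : K) != 0 -> (0 < k)%N -> sym_idempotent Q -> \rank Q = k ->
  exists2 g, SO K (k + m) g & g *m coord_proj *m g^T = Q.
Proof.
move=> two_neq0 k_gt0 Q_idem rkQ.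
have [h hh hQ] := sym_idempotent_closed two_neq0 Q_idem rkQ.
have thh : h^T *m h = 1%:M by apply: mulmx1C.
have det_h : \det h = 1 \/ \det h = -1.
  have := congr1 determinant hh; rewrite det_mulmx det_tr det1 -expr2 => /eqP.
  by rewrite sqrf_eq1 => /orP[]/eqP; [left | right].
case: det_h => det_h.
  by exists h^T; [split; rewrite ?trmxK ?det_tr | rewrite trmxK].
(* Determinant -1 is corrected by a sign change of the first coordinate, which is diagonal and so
   commutes with [coord_proj]. *)
pose s : 'M[K]_(k + m) := diag_mx (\row_j if (j == 0 :> nat) then -1 else 1).
have ss : s *m s = 1%:M.
  rewrite /s mulmx_diag -[RHS]diag_const_mx; congr diag_mx; apply/rowP => j; rewrite !mxE.
  by case: ifP; rewrite ?mulrNN mulr1.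
have ts : s^T = s by rewrite /s tr_diag_mx.
have sDs : s *m coord_proj *m s = coord_proj.
  rewrite coord_proj_diag /s -!mulmxA !mulmx_diag; congr diag_mx; apply/rowP => j; rewrite !mxE.
  by case: ifP; rewrite ?mulrN ?mulr1 ?mulN1r ?opprK ?mul1r.
have det_s : \det s = -1.
  rewrite det_diag; case: k k_gt0 => // k' _.
  by rewrite /= big_ord_recl big1 /= ?mxE ?mulr1 // => j _; rewrite mxE.
exists (h^T *m s).
  split; first by rewrite trmx_mul trmxK ts -mulmxA (mulmxA h) hh mul1mx.
  by rewrite det_mulmx det_tr det_h det_s mulrNN mulr1.
by rewrite form_mul ts sDs trmxK.
Qed.

Lemma coset_sym_idempotent (g : 'M[K]_(k + m)) :
  SO K (k + m) g ->
  sym_idempotent (g *m coord_proj *m g^T) /\ \rank (g *m coord_proj *m g^T) = k.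
Proof.
move=> [tgg det_g].
have DD : coord_proj *m coord_proj = coord_proj.
  by rewrite /coord_proj mulmx_block !(mulmx0, mul0mx, addr0) mulmx1.
have tD : coord_proj^T = coord_proj by rewrite coord_proj_diag tr_diag_mx.
split.
  rewrite /sym_idempotent form_sym // eqxx /=; apply/eqP.
  by rewrite -!mulmxA (mulmxA g^T) tgg mul1mx (mulmxA coord_proj) DD.
have g_unit : g \in unitmx by rewrite unitmxE det_g unitr1.
rewrite mxrankMfree ?row_free_unit ?unitmx_tr //.
rewrite -mxrank_tr trmx_mul tD mxrankMfree ?row_free_unit ?unitmx_tr //.
by rewrite /coord_proj -pid_mx_block rank_pid_mx // leq_addr.
Qed.

End Cosets.

(** * Frobenius-fixed cosets *)

Section FrobeniusCosets.
Variables (K : closedFieldType) (q k m : nat).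
Variable char_q : [pchar K].-nat q.

Lemma frobenius_mxE n : @frobenius_mx K n q = map_mx (frob char_q).
Proof. by []. Qed.

Lemma frobenius_mx_surj n (h : 'M[K]_n) : exists g, frobenius_mx q g = h.
Proof.
have q_gt0 : (0 < q)%N by case/andP: char_q.
have root a : exists x : K, x ^+ q == a.
  have [x xq] := @solve_monicpoly K q (fun i => if i == 0%N then a else 0) q_gt0.
  exists x; rewrite xq; case: (q) q_gt0 => // q' _.
  by rewrite big_ord_recl big1 => [|i _]; rewrite /= ?mul0r // addr0 expr0 mulr1.
exists (\matrix_(i, j) xchoose (root (h i j))); apply/matrixP => i j; rewrite !mxE.
exact/eqP/(xchooseP (root (h i j))).
Qed.

Lemma frobenius_mx_inj n : injective (@frobenius_mx K n q).
Proof. by rewrite frobenius_mxE; apply: map_mx_inj. Qed.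

Lemma frobenius_SO n (g : 'M[K]_n) : SO K n (frobenius_mx q g) <-> SO K n g.
Proof.
rewrite /SO /= frobenius_mxE map_trmx -map_mxM det_map_mx.
split=> -[gg det_g]; split.
- by apply: (@frobenius_mx_inj n); rewrite frobenius_mxE gg map_mx1.
- by apply: (fmorph_inj (frob char_q)); rewrite det_g rmorph1.
- by rewrite gg map_mx1.
- by rewrite det_g rmorph1.
Qed.

Lemma frobenius_proj (g : 'M[K]_(k + m)) :
  frobenius_mx q g *m coord_proj K k m *m (frobenius_mx q g)^T =
  frobenius_mx q (g *m coord_proj K k m *m g^T).
Proof.
rewrite frobenius_mxE map_trmx !map_mxM; congr (_ *m _ *m _).
by rewrite /coord_proj map_block_mx map_mx1 !map_mx0.
Qed.

Lemma frobenius_proj_coset (Q : 'M[K]_(k + m)) :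
  frobenius_mx q @` proj_coset Q = proj_coset (frobenius_mx q Q).
Proof.
apply/seteqP; split=> [_ [h [SOh <-] <-]|h [SOh hQ]].
  by split; [apply/frobenius_SO | rewrite frobenius_proj].
have [g gh] := frobenius_mx_surj h; rewrite -{}gh in SOh hQ *.
exists g => //; split; first exact/frobenius_SO.
by apply: (@frobenius_mx_inj (k + m)); rewrite -frobenius_proj.
Qed.

End FrobeniusCosets.

(** * Descent from the closed field to the finite field *)

Lemma pchar_card_finField (F : finFieldType) (K : fieldType) (iota : {rmorphism F -> K}) :
  [pchar K].-nat #|F|.
Proof.
have [p p_pr charFp] := finPcharP F.
rewrite (card_pprimeChar charFp) pnatX pnatE // (fmorph_pchar iota) charFp.
by [].
Qed.

Lemma odd_card_two_neq0 (F : finFieldType) : odd #|F| -> (2%:R : F) != 0.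
Proof.
move=> odd_q; apply/negP => /eqP two0.
have charF2 : 2 \in [pchar F] by rewrite inE /= two0 eqxx.
have := finNzRing_gt1 F; move: odd_q; rewrite (card_pprimeChar charF2) oddX orbF => /eqP ->.
by [].
Qed.

(** Over [F] the polynomial ['X^#|F| - 'X] is the product of all ['X - a], so it has no further
    roots in [K]. *)
Lemma fixed_by_power_card (F : finFieldType) (K : fieldType) (iota : {rmorphism F -> K}) (x : K) :
  x ^+ #|F| = x -> exists a, x = iota a.
Proof.
move=> xq; have := congr1 (fun p => (map_poly iota p).[x]) (finField_genPoly F).
rewrite rmorphB /= map_polyXn map_polyX hornerD hornerN hornerXn hornerX xq subrr.
rewrite rmorph_prod horner_prod => /esym/eqP/prodf_eq0[a _].
rewrite rmorphB /= map_polyX map_polyC hornerXsubC subr_eq0 => /eqP ->.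
by exists a.
Qed.

Lemma sym_idempotent_map (F K : fieldType) (iota : {rmorphism F -> K}) (n : nat) (Q : 'M[F]_n) :
  sym_idempotent (map_mx iota Q) = sym_idempotent Q.
Proof. by rewrite /sym_idempotent map_trmx -map_mxM !(inj_eq (@map_mx_inj _ _ iota _ _)). Qed.

Lemma Gr_frobenius_fixedE (F : finFieldType) (K : closedFieldType) (iota : {rmorphism F -> K})
    (k m : nat) :
  (2%:R : F) != 0 -> (0 < k)%N ->
  Gr_frobenius_fixed K (k + m) k #|F| =
  [set proj_coset (map_mx iota Q) | Q in [set Q | sym_idempotent Q /\ \rank Q = k]].
Proof.
move=> two_neq0 k_gt0.
have two_neq0K : (2%:R : K) != 0 by rewrite -(rmorph_nat iota) fmorph_eq0.
have char_q := pchar_card_finField iota.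
apply/seteqP; split=> [C [[g SOg <-]]|_ [Q [Q_idem rkQ] <-]].
  rewrite mxlcoset_proj // frobenius_proj_coset //.
  move=> coset_fixed; set Q := g *m coord_proj K k m *m g^T in coset_fixed *.
  (* [g] lies in the coset of [Q], hence in that of its Frobenius image, so the two matrices
     agree. *)
  have [_ Q_fixed] : proj_coset (frobenius_mx #|F| Q) g by rewrite coset_fixed.
  have [Qt QtQ] : exists Qt, Q = map_mx iota Qt.
    have entry i j : exists a, Q i j == iota a.
      have [|a ->] := @fixed_by_power_card _ _ iota (Q i j); last by exists a.
      by have /matrixP/(_ i j) := Q_fixed; rewrite -/Q !mxE => <-.
    exists (\matrix_(i, j) xchoose (entry i j)); apply/matrixP => i j.
    by rewrite [RHS]mxE [X in iota X]mxE; apply/eqP/(xchooseP (entry i j)).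
  exists Qt; last by rewrite -QtQ.
  have [Q_idem rkQ] := coset_sym_idempotent SOg.
  by rewrite /= -(mxrank_map iota) -(sym_idempotent_map iota) -QtQ.
have [||g SOg gQ] := @proj_coset_nonempty _ k m (map_mx iota Q) two_neq0K k_gt0.
- by rewrite sym_idempotent_map.
- by rewrite mxrank_map.
split; first by exists g => //; rewrite mxlcoset_proj // gQ.
rewrite frobenius_proj_coset //; congr proj_coset; apply/matrixP => i j; rewrite !mxE.
by rewrite -rmorphXn /= expf_card.
Qed.

Theorem theorem4p3 (n k : nat) (k_gt0 : (1 <= k)%N) (k_le : (k <= n - 1)%N)
    (q : nat) (F : finFieldType) (card_F : #|F| = q)
    (odd_q : odd q) (sqrtN1 : exists i : F, i ^+ 2 = -1)
    (Fbar : closedFieldType) (iota : {rmorphism F -> Fbar})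
    (Fbar_alg : forall x : Fbar, algebraicOver iota x) :
  let p := gr_poly n k in
  let r := (k * (n - k) - (size p).-1)%N in
  exists N : nat, (Gr_frobenius_fixed Fbar n k q #= `I_N)%card /\
    N%:Z = q%:Z ^+ r * p.[q%:Z].
Proof.
have le_kn : (k <= n)%N by lia.
rewrite -(subnKC le_kn) addKn {k_le le_kn}; move: (n - k)%N => m /=.
have two_neq0 : (2%:R : F) != 0 by apply: odd_card_two_neq0; rewrite card_F.
have two_neq0K : (2%:R : Fbar) != 0 by rewrite -(rmorph_nat iota) fmorph_eq0.
case: sqrtN1 => i ii.
pose A := [set Q : 'M[F]_(k + m) | sym_idempotent Q & \rank Q == k]%SET.
exists #|A|; split; last first.
  have q_gt1 := card_finField_gt1 F.
  have sq_neq0 j : sq_factorial q%:Z j != 0.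
    apply/prodf_neq0 => h _; rewrite -card_F -exprM.
    have : 1 < #|F|%:Z ^+ (h.+1 * 2) by rewrite Num.Theory.exprn_egt1.
    by move: (_ ^+ _) => y; lia.
  (* After multiplication by the nonzero denominators both sides equal [gr_count]. *)
  apply: (mulfI (mulf_neq0 (sq_neq0 k./2) (sq_neq0 m./2))).
  rewrite [RHS](gr_poly_count k m q%:Z) -card_F.
  exact: card_sym_idempotents_form two_neq0 ii k_gt0.
rewrite -card_F (Gr_frobenius_fixedE iota m two_neq0 k_gt0).
set f := fun Q => proj_coset (map_mx iota Q).
(* Enumerating [A] presents the cosets as the image of an initial segment, so only injectivity is
   left. *)
have -> : f @` [set Q | sym_idempotent Q /\ \rank Q = k] = (f \o nth 0 (enum A)) @` `I_#|A|.
  apply/seteqP; split=> [_ [Q [Q_idem rkQ] <-]|_ [j /= lt_j <-]].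
    have Q_A : Q \in enum A by rewrite mem_enum inE Q_idem rkQ eqxx.
    exists (index Q (enum A)) => /=; first by rewrite cardE index_mem.
    by rewrite nth_index.
  have : nth 0 (enum A) j \in enum A by rewrite mem_nth // -cardE.
  by rewrite mem_enum inE => /andP[Q_idem /eqP rkQ]; exists (nth 0 (enum A) j).
apply: inj_card_eq => j j'; rewrite !inE /= => lt_j lt_j' fE.
have mem_A h : (h < #|A|)%N -> sym_idempotent (nth 0 (enum A) h) /\ \rank (nth 0 (enum A) h) = k.
  move=> lt_h; have : nth 0 (enum A) h \in enum A by rewrite mem_nth // -cardE.
  by rewrite mem_enum inE => /andP[? /eqP ?].
have [j_idem rk_j] := mem_A j lt_j.
(* The coset is nonempty, and an element [g] shared by two cosets recovers both matrices as
   [g *m coord_proj *m g^T]. *)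
have [||g SOg gQ] := @proj_coset_nonempty _ k m (map_mx iota (nth 0 (enum A) j)) two_neq0K k_gt0.
- by rewrite sym_idempotent_map.
- by rewrite mxrank_map.
have [_ gQ'] : f (nth 0 (enum A) j') g by rewrite -fE; split.
apply/eqP; rewrite -(nth_uniq 0 _ _ (enum_uniq A)) -?cardE //; apply/eqP.
by apply: (@map_mx_inj _ _ iota); rewrite -gQ gQ'.
Qed.
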